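(* Let $\bar x\in\Phi$ be a local second-order weak sharp minimizer of problem (P) with corresponding constants $\kappa>0$ and $\delta>0$. Suppose that DirRCQ holds at every $x\in\Phi\cap B_\delta(\bar x)$ in every direction $d\in C(x)$. Then for any $\varepsilon\in[0,1/2)$, $x\in S\cap B_\delta(\bar x)$ and $d\in C(x)\cap N^{P,\varepsilon}_S(x)$: (i) for every $v\in T''_K(g(x);\nabla g(x)d)$ there exists $\lambda_v\in\Lambda^c(x;d)$ with $\langle\lambda_v,v\rangle\le0$; (ii) for every $w\in T^2_K(g(x);\nabla g(x)d)$ there exists $\lambda_w\in\Lambda^c(x;d)$ with $\nabla^2_{xx}L(x,\lambda_w)(d,d)-\langle\lambda_w,w\rangle\ge2\kappa(1-2\varepsilon)^2\|d\|^2$. Moreover, for every $x\in S\cap B_\delta(\bar x)$ and every $d\in C(x)$, (i) holds and (ii) holds with the right-hand side replaced by $2\kappa[\mathrm{dist}(d,T_S(x))]^2$.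
   Context: Standing setting: $f:\mathbb{R}^n\to\mathbb{R}$, $g:\mathbb{R}^n\to\mathbb{R}^m$ twice continuously differentiable, $K\subset\mathbb{R}^m$ closed; (P) is $\min f(x)$ s.t. $g(x)\in K$; $\Phi:=\{x:g(x)\in K\}$; $S$ is the (nonempty) set of optimal solutions; $L(x,\lambda):=f(x)+\langle g(x),\lambda\rangle$. $\bar x\in\Phi$ is a local second-order weak sharp minimizer with constants $\kappa,\delta>0$ if $f(x)\ge f(\bar x)+\kappa[\mathrm{dist}(x,S)]^2$ for all $x\in\Phi\cap B_\delta(\bar x)$. For a closed set $A$ and $\bar x\in A$: $T_A(\bar x):=\{d:\exists t_k\downarrow0,d_k\to d,\bar x+t_kd_k\in A\}$; for $d\in T_A(\bar x)$, $T^2_A(\bar x;d):=\{w:\exists t_k\downarrow0,w_k\to w,\bar x+t_kd+\tfrac12t_k^2w_k\in A\}$, $T''_A(\bar x;d):=\{w:\exists(t_k,r_k)\downarrow(0,0),t_k/r_k\to0,w_k\to w,\bar x+t_kd+\tfrac12t_kr_kw_k\in A\}$. $C(x):=\{d:\nabla g(x)d\in T_K(g(x)),\nabla f(x)d\le0\}$. $N^P_A(\bar x):=\{v:\exists\tau>0,\ \bar x\text{ is a nearest point of }A\text{ to }\bar x+\tau v\}$; $N^{P,\varepsilon}_A(\bar x):=\{v:\mathrm{dist}(v,N^P_A(\bar x))\le\varepsilon\|v\|\}$. Fréchet normal cone $\hat N_A(y):=\{v:\limsup_{y'\to y,y'\in A}\langle v,y'-y\rangle/\|y'-y\|\le0\}$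 (empty if $y\notin A$); directional limiting normal cone $N_A(\bar y;u):=\{v:\exists t_k\downarrow0,u_k\to u,v_k\to v,\ v_k\in\hat N_A(\bar y+t_ku_k)\}$; directional Clarke normal cone $N^c_A(\bar y;u):=\mathrm{cl}\,\mathrm{co}\,N_A(\bar y;u)$. Directional C-multiplier set: $\Lambda^c(x;d):=\{\lambda:\nabla_xL(x,\lambda)=0,\ \lambda\in N^c_K(g(x);\nabla g(x)d)\}$. DirRCQ holds at $x$ in direction $d$ if $\nabla g(x)^T\lambda=0,\ \lambda\in N^c_K(g(x);\nabla g(x)d)$ imply $\lambda=0$. $\nabla^2g(x)(d,d):=(d^T\nabla^2g_i(x)d)_{i=1}^m$. *)

(* Defs.v *)
From HB Require Import structures.
From mathcomp Require Import all_boot all_order all_algebra.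
From mathcomp Require Import all_classical all_reals all_analysis.
Set Implicit Arguments. Unset Strict Implicit. Unset Printing Implicit Defensive.
Import Order.TTheory GRing.Theory Num.Theory.
Import numFieldNormedType.Exports.
Local Open Scope classical_set_scope.
Local Open Scope ring_scope.

Section Defs.
Variable R : realType.

(* Euclidean inner product and norm on R^k (the library norm on 'rV is the sup norm). *)
Definition dotv (k : nat) (u v : 'rV[R]_k) : R := \sum_(i < k) u 0 i * v 0 i.
Definition eunorm (k : nat) (u : 'rV[R]_k) : R := Num.sqrt (dotv u u).

Definition setdist (k : nat) (x : 'rV[R]_k) (A : set 'rV[R]_k) : R :=
  inf [set eunorm (x - a) | a in A].

Definition eball (k : nat) (c : 'rV[R]_k) (r : R) : set 'rV[R]_k :=
  [set x | eunorm (x - c) < r].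

Definition C2 (k l : nat) (f : 'rV[R]_k -> 'rV[R]_l) : Prop :=
  (forall x, differentiable f x) /\
  (forall v x, differentiable (fun y => 'd f y v) x) /\
  (forall u v, continuous (fun y => 'd (fun z => 'd f z v) y u)).

Definition grad (k l : nat) (f : 'rV[R]_k -> 'rV[R]_l) (x d : 'rV[R]_k) : 'rV[R]_l :=
  'd f x d.
Definition hess2 (k l : nat) (f : 'rV[R]_k -> 'rV[R]_l) (x d : 'rV[R]_k) : 'rV[R]_l :=
  'd (fun y => 'd f y d) x d.

Definition down0 (t : nat -> R) : Prop := (forall k, 0 < t k) /\ t @ \oo --> 0.

Definition Tcone (k : nat) (A : set 'rV[R]_k) (x : 'rV[R]_k) : set 'rV[R]_k :=
  [set d | exists (t : nat -> R) (dk : nat -> 'rV[R]_k),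
      down0 t /\ dk @ \oo --> d /\ forall j, A (x + t j *: dk j)].

Definition T2set (k : nat) (A : set 'rV[R]_k) (x d : 'rV[R]_k) : set 'rV[R]_k :=
  [set w | exists (t : nat -> R) (wk : nat -> 'rV[R]_k),
      down0 t /\ wk @ \oo --> w /\
      forall j, A (x + t j *: d + (2^-1 * t j ^+ 2) *: wk j)].

Definition T2asym (k : nat) (A : set 'rV[R]_k) (x d : 'rV[R]_k) : set 'rV[R]_k :=
  [set w | exists (t r : nat -> R) (wk : nat -> 'rV[R]_k),
      down0 t /\ down0 r /\ (fun j => t j / r j) @ \oo --> 0 /\
      wk @ \oo --> w /\
      forall j, A (x + t j *: d + (2^-1 * t j * r j) *: wk j)].

Definition NPcone (k : nat) (A : set 'rV[R]_k) (x : 'rV[R]_k) : set 'rV[R]_k :=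
  [set v | A x /\ exists tau : R, 0 < tau /\
      forall a, A a -> eunorm (x + tau *: v - x) <= eunorm (x + tau *: v - a)].

Definition NPeps (k : nat) (A : set 'rV[R]_k) (x : 'rV[R]_k) (eps : R) : set 'rV[R]_k :=
  [set v | setdist v (NPcone A x) <= eps * eunorm v].

(* Frechet (regular) normal cone; empty outside A. The condition
   limsup_{y'->y, y' in A} <v, y'-y>/||y'-y|| <= 0 is written out. *)
Definition Fnormal (k : nat) (A : set 'rV[R]_k) (y : 'rV[R]_k) : set 'rV[R]_k :=
  [set v | A y /\ forall e : R, 0 < e -> exists r : R, 0 < r /\
      forall y', A y' -> eunorm (y' - y) < r -> dotv v (y' - y) <= e * eunorm (y' - y)].

Definition Ndir (k : nat) (A : set 'rV[R]_k) (y u : 'rV[R]_k) : set 'rV[R]_k :=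
  [set v | exists (t : nat -> R) (uk vk : nat -> 'rV[R]_k),
      down0 t /\ uk @ \oo --> u /\ vk @ \oo --> v /\
      forall j, Fnormal A (y + t j *: uk j) (vk j)].

Definition convhull (k : nat) (A : set 'rV[R]_k) : set 'rV[R]_k :=
  [set x | exists (p : nat) (a : 'I_p -> 'rV[R]_k) (l : 'I_p -> R),
      (forall i, A (a i)) /\ (forall i, 0 <= l i) /\ \sum_(i < p) l i = 1 /\
      x = \sum_(i < p) l i *: a i].

Definition NCdir (k : nat) (A : set 'rV[R]_k) (y u : 'rV[R]_k) : set 'rV[R]_k :=
  closure (convhull (Ndir A y u)).

Variables (n m : nat) (f : 'rV[R]_n -> 'rV[R]_1) (g : 'rV[R]_n -> 'rV[R]_m)
  (K : set 'rV[R]_m).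

Definition fval (x : 'rV[R]_n) : R := f x 0 0.

Definition Phi : set 'rV[R]_n := [set x | K (g x)].
Definition Sol : set 'rV[R]_n :=
  [set x | Phi x /\ forall y, Phi y -> fval x <= fval y].

Definition local_sowsm (xbar : 'rV[R]_n) (kappa delta : R) : Prop :=
  Phi xbar /\ forall x, Phi x -> eball xbar delta x ->
    fval x >= fval xbar + kappa * (setdist x Sol) ^+ 2.

Definition Ccone (x : 'rV[R]_n) : set 'rV[R]_n :=
  [set d | Tcone K (g x) (grad g x d) /\ grad f x d 0 0 <= 0].

(* directional C-multiplier set Lambda^c(x; d):
   nabla_x L(x,lam) = 0 (as a linear functional) and lam in N^c_K(g(x); nabla g(x) d) *)
Definition Lambdac (x d : 'rV[R]_n) : set 'rV[R]_m :=
  [set lam | (forall h, grad f x h 0 0 + dotv lam (grad g x h) = 0) /\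
             NCdir K (g x) (grad g x d) lam].

Definition DirRCQ (x d : 'rV[R]_n) : Prop :=
  forall lam, NCdir K (g x) (grad g x d) lam ->
    (forall h, dotv lam (grad g x h) = 0) -> lam = 0.

Definition hessL (x : 'rV[R]_n) (lam : 'rV[R]_m) (d : 'rV[R]_n) : R :=
  hess2 f x d 0 0 + dotv lam (hess2 g x d).

Definition prop_i (x d : 'rV[R]_n) : Prop :=
  forall v, T2asym K (g x) (grad g x d) v ->
    exists lam, Lambdac x d lam /\ dotv lam v <= 0.

Definition prop_ii (x d : 'rV[R]_n) (rhs : R) : Prop :=
  forall w, T2set K (g x) (grad g x d) w ->
    exists lam, Lambdac x d lam /\ hessL x lam d - dotv lam w >= rhs.

End Defs.

(* Main.v *)
Require Import Defs.
From HB Require Import structures.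
From mathcomp Require Import all_boot all_order all_algebra.
From mathcomp Require Import all_classical all_reals all_analysis.
From mathcomp Require Import ring lra.
Import Order.TTheory GRing.Theory Num.Theory.
Import numFieldNormedType.Exports.
Local Open Scope classical_set_scope.
Local Open Scope ring_scope.

Set Implicit Arguments.
Unset Strict Implicit.
Unset Printing Implicit Defensive.

(** The closed convex cone [N = NCdir K (g x) (grad g x d)] meets the kernel of the
    adjoint of the Jacobian only at 0, so conic linear duality holds without a gap:
    either the required multiplier exists, or there is a [z] such that
    [grad g x z + hess2 g x d - w] lies in the polar of [N] and the second-order
    expansion of the objective along [x + t d + t^2/2 z] is too small.
    Polarity to the directional limiting normals makes the elements of the polar of [N]
    directional Clarke tangents: points of [K] close to [g x + t grad g x d] can be moved
    in such a direction while staying in [K] up to a small relative error.  DirRCQ gives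
    metric subregularity of [g] in direction [d], which corrects [x + t d + t^2/2 z] to a
    feasible point.  The growth inequality there, divided by [t^2/2], contradicts the
    choice of [z], because the limit points of [(S - x) / t] are tangent to [S].  The
    first assertion uses the same arcs with step [t r / 2] and mere optimality of [x].
    Finally, a proximal normal has nonpositive product with every tangent, so
    [dist (d, T_S(x)) >= (1 - 2 eps) |d|] when [d] is an [eps]-proximal normal. *)

(** * Euclidean geometry *)

Ltac vector_ring := apply/rowP => ?; rewrite !mxE; ring.

Section InnerProduct.
Variables (R : realType) (k : nat).
Implicit Types u v w : 'rV[R]_k.

Lemma dotvC u v : dotv u v = dotv v u.
Proof. by apply: eq_bigr => i _; rewrite mulrC. Qed.

Lemma dotvDl u v w : dotv (u + v) w = dotv u w + dotv v w.
Proof. by rewrite -big_split; apply: eq_bigr => i _; rewrite mxE mulrDl. Qed.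

Lemma dotvZl a u v : dotv (a *: u) v = a * dotv u v.
Proof. by rewrite mulr_sumr; apply: eq_bigr => i _; rewrite mxE mulrA. Qed.

Lemma dotvDr u v w : dotv w (u + v) = dotv w u + dotv w v.
Proof. by rewrite dotvC dotvDl !(dotvC w). Qed.

Lemma dotvZr a u v : dotv u (a *: v) = a * dotv u v.
Proof. by rewrite dotvC dotvZl dotvC. Qed.

Lemma dotvNl u v : dotv (- u) v = - dotv u v.
Proof. by rewrite -scaleN1r dotvZl mulN1r. Qed.

Lemma dotvNr u v : dotv u (- v) = - dotv u v.
Proof. by rewrite dotvC dotvNl dotvC. Qed.

Lemma dotv0l v : dotv 0 v = 0.
Proof. by rewrite -(scale0r 0) dotvZl mul0r. Qed.

Lemma dotv0r v : dotv v 0 = 0.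
Proof. by rewrite dotvC dotv0l. Qed.

Definition dotvE :=
  (dotvDl, dotvDr, dotvZl, dotvZr, dotvNl, dotvNr, dotv0l, dotv0r).

Lemma dotvv_ge0 u : 0 <= dotv u u.
Proof. by apply: sumr_ge0 => i _; rewrite -expr2 sqr_ge0. Qed.

Lemma dotvv_eq0 u : (dotv u u == 0) = (u == 0).
Proof.
apply/eqP/eqP => [/eqP|->]; last by rewrite dotv0l.
rewrite psumr_eq0 => [/allP uu0|i _]; last by rewrite -expr2 sqr_ge0.
apply/rowP => i; rewrite mxE; apply/eqP.
by have := uu0 i (mem_index_enum i); rewrite /= mulf_eq0 orbb.
Qed.

Lemma eunorm_ge0 u : 0 <= eunorm u.
Proof. exact: sqrtr_ge0. Qed.

End InnerProduct.
#[local] Hint Extern 0 (is_true (0 <= eunorm _)) => exact: eunorm_ge0 : core.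

Section EuclideanNorm.
Variables (R : realType) (k : nat).
Implicit Types u v x y z : 'rV[R]_k.

Lemma sqr_eunorm u : eunorm u ^+ 2 = dotv u u.
Proof. by rewrite sqr_sqrtr // dotvv_ge0. Qed.

Lemma eunorm_eq0 u : (eunorm u == 0) = (u == 0).
Proof. by rewrite -sqrf_eq0 sqr_eunorm dotvv_eq0. Qed.

Lemma eunorm0 : eunorm (0 : 'rV[R]_k) = 0.
Proof. by apply/eqP; rewrite eunorm_eq0. Qed.

Lemma eunorm_gt0 u : (0 < eunorm u) = (u != 0).
Proof. by rewrite lt_neqAle eunorm_ge0 andbT eq_sym eunorm_eq0. Qed.

Lemma eunormZ a u : eunorm (a *: u) = `|a| * eunorm u.
Proof. by rewrite /eunorm !dotvE mulrA -expr2 sqrtrM ?sqr_ge0 // sqrtr_sqr. Qed.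

Lemma eunorm_normalize u : u != 0 -> eunorm ((eunorm u)^-1 *: u) = 1.
Proof.
by rewrite -eunorm_gt0 => u0; rewrite eunormZ gtr0_norm ?invr_gt0 // mulVf ?gt_eqF.
Qed.

Lemma eunorm_distC u v : eunorm (u - v) = eunorm (v - u).
Proof. by rewrite -opprB -scaleN1r eunormZ normrN1 mul1r. Qed.

Lemma eunormD_sqr u v :
  eunorm (u + v) ^+ 2 = eunorm u ^+ 2 + 2 * dotv u v + eunorm v ^+ 2.
Proof. by rewrite !sqr_eunorm !dotvE (dotvC v u); ring. Qed.

Lemma normr_dotv_le u v : `|dotv u v| <= eunorm u * eunorm v.
Proof.
rewrite -ler_sqr ?nnegrE ?mulr_ge0 // exprMn !sqr_eunorm real_normK ?num_real //.
have [->|v0] := eqVneq v 0; first by rewrite !dotvE mulr0 expr0n.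
have vv0 : 0 < dotv v v by rewrite lt_neqAle eq_sym dotvv_eq0 v0 dotvv_ge0.
rewrite -subr_ge0 -(pmulr_rge0 _ vv0).
apply: le_trans (dotvv_ge0 (dotv v v *: u - dotv u v *: v)) _.
by rewrite !dotvE (dotvC v u); lra.
Qed.

Lemma dotv_le u v : dotv u v <= eunorm u * eunorm v.
Proof. exact: le_trans (ler_norm _) (normr_dotv_le u v). Qed.

Lemma eunormD_le u v : eunorm (u + v) <= eunorm u + eunorm v.
Proof.
rewrite -ler_sqr ?nnegrE ?addr_ge0 // eunormD_sqr.
have := dotv_le u v; lra.
Qed.

Lemma eunorm_distD z x y : eunorm (x - y) <= eunorm (x - z) + eunorm (z - y).
Proof. by apply: le_trans (eunormD_le _ _); rewrite addrA subrK. Qed.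

Lemma addr_scale_subK (t : R) x y : t != 0 -> x + t *: (t^-1 *: (y - x)) = y.
Proof. by move=> t0; rewrite scalerA divff // scale1r addrC subrK. Qed.

Lemma normr_coord_le_eunorm u i : `|u 0 i| <= eunorm u.
Proof.
rewrite -ler_sqr ?nnegrE // real_normK ?num_real // sqr_eunorm /dotv (bigD1 i) //=.
by rewrite -expr2 lerDl sumr_ge0 // => j _; rewrite -expr2 sqr_ge0.
Qed.

Lemma norm_le_eunorm u : `|u| <= eunorm u.
Proof.
rewrite [leLHS]/Num.Def.normr /= mx_normrE; apply: bigmax_le => //.
by move=> [j i] _ /=; rewrite ord1 normr_coord_le_eunorm.
Qed.

End EuclideanNorm.

Section Convergence.
Variables (R : realType) (T : Type) (F : set_system T) (k : nat).
Context {FF : Filter F}.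
Implicit Types (u v : T -> 'rV[R]_k) (a b : 'rV[R]_k).

Lemma cvg_rowP u a :
  u @ F --> a <-> forall i, u x 0 i @[x --> F] --> a 0 i.
Proof.
split=> [ua i|ua].
  by apply: (cvg_comp u (fun y : 'rV_k => y 0 i) ua); exact: coord_continuous.
apply/cvgrPdist_le => e e0.
have /filter_forall : forall i, \forall x \near F, `|a 0 i - u x 0 i| <= e.
  by move=> i; have /cvgrPdist_le := ua i; apply.
apply: filterS => x aux; rewrite [leLHS]/Num.Def.normr /= mx_normrE.
apply: bigmax_le => [|[j i] _]; first exact: ltW.
by rewrite !mxE ord1; exact: aux.
Qed.

Lemma cvgD_scale0 u v a b (s : T -> R) : u @ F --> a -> s @ F --> 0 -> v @ F --> b ->
  (fun x => u x + s x *: v x) @ F --> a.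
Proof.
by move=> ua s0 vb; rewrite -[a]addr0 -(scale0r b); apply: cvgD ua _; exact: cvgZ.
Qed.

Lemma cvg_dotv u v a b : u @ F --> a -> v @ F --> b ->
  dotv (u x) (v x) @[x --> F] --> dotv a b.
Proof.
move=> /cvg_rowP ua /cvg_rowP vb; apply: cvg_big => [|i _]; first exact: add_continuous.
exact: cvgM.
Qed.

Lemma cvg_eunorm u a : u @ F --> a ->
  eunorm (u x) @[x --> F] --> eunorm a.
Proof.
move=> ua; apply: (cvg_comp _ Num.sqrt (cvg_dotv ua ua)).
exact: sqrt_continuous.
Qed.

Lemma cvg_eunorm_distP u a :
  u @ F --> a <-> eunorm (u x - a) @[x --> F] --> 0.
Proof.
split=> [ua|ua].
  rewrite -(eunorm0 R k) -(subrr a); apply: cvg_eunorm.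
  by apply: cvgB ua _; exact: cvg_cst.
apply/cvgrPdist_lt => e /(cvgr_lt _ ua); apply: filterS => x.
by rewrite distrC; exact: le_lt_trans (norm_le_eunorm _).
Qed.

Lemma cvg_eunorm_lt u a (e : R) : u @ F --> a -> 0 < e ->
  \forall x \near F, eunorm (u x - a) < e.
Proof. by move=> /cvg_eunorm_distP ua e0; exact: cvgr_lt ua _ e0. Qed.

Lemma cvg0_eunorm_le u (r : T -> R) :
  (\forall x \near F, eunorm (u x) <= r x) -> r @ F --> 0 -> u @ F --> (0 : 'rV[R]_k).
Proof.
move=> ur r0; apply/cvg_eunorm_distP.
apply: (@squeeze_cvgr _ _ _ _ (cst 0) r) (cvg_cst _) r0.
by apply: filterS ur => x; rewrite subr0 eunorm_ge0.
Qed.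

End Convergence.

Section Compactness.
Variables (R : realType) (k : nat).
Implicit Types (A : set 'rV[R]_k) (F : 'rV[R]_k -> R) (x y z : 'rV[R]_k).

Lemma continuous_eunorm : continuous (@eunorm R k).
Proof. by move=> x; exact: (@cvg_eunorm _ _ (nbhs x) _ _ id). Qed.

Lemma nbhs_eunorm_lt x (e : R) : 0 < e -> \forall y \near x, eunorm (y - x) < e.
Proof. exact: (cvg_eunorm_lt (F := nbhs x) (@cvg_id _ _)). Qed.

Lemma closed_sublevel (T : topologicalType) (G : T -> R) (c : R) : continuous G ->
  closed [set x | G x <= c].
Proof.
by move=> Gc; apply: (@preimage_closed _ _ G) (@closed_le _ c) => x _; exact: Gc.
Qed.

Lemma eunorm_bounded_compact A (M : R) : closed A ->
  (forall x, A x -> eunorm x <= M) -> compact A.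
Proof.
move=> Acl AM; apply: bounded_closed_compact Acl; exists M; split=> [|N MN x Ax].
  exact: num_real.
exact: le_trans (norm_le_eunorm _) (le_trans (AM x Ax) (ltW MN)).
Qed.

Lemma coercive_min F A a (M : R) : continuous F -> closed A -> A a ->
  (forall x, A x -> F x <= F a -> eunorm x <= M) ->
  exists2 y, A y & forall z, A z -> F y <= F z.
Proof.
move=> Fc Acl Aa AM; pose B := A `&` [set x | F x <= F a].
have Bcl : closed B.
  by apply: closedI => //; exact: closed_sublevel.
have [|||y /set_mem[Ay ya] ymin] := @compact_EVT_min _ _ F B.
- by exists a; split => /=.
- by apply: (eunorm_bounded_compact (M := M)) => // x [Ax]; exact: AM.
- exact: continuous_subspaceT.
exists y => // z Az; have [za|az] := leP (F z) (F a).
  by apply: ymin; apply/mem_set.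
exact: le_trans ya (ltW az).
Qed.

Lemma bounded_subseq (xs : nat -> 'rV[R]_k) (M : R) :
  (\forall j \near \oo, eunorm (xs j) <= M) ->
  exists h : nat -> nat, exists2 x : 'rV[R]_k, h @ \oo --> \oo & (xs \o h) @ \oo --> x.
Proof.
move=> xsM; pose A := [set x : 'rV[R]_k | eunorm x <= M].
have Acl : closed A.
  by apply: closed_sublevel; exact: continuous_eunorm.
have [x [_ xcl]] : A `&` cluster (xs @ \oo) !=set0.
  exact: (eunorm_bounded_compact Acl (fun _ => id)).
have /choice[h hP] j : exists N, (j <= N)%N /\ eunorm (xs N - x) < j.+1%:R^-1.
  have [|_ [[N /= jN <-] Nx]] := xcl (xs @` [set N | (j <= N)%N])
      [set y | eunorm (y - x) < j.+1%:R^-1] _ (nbhs_eunorm_lt x (harmonic_gt0 j)).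
    by exists j => // N jN; exists N.
  by exists N.
exists h, x.
  apply/cvgnyPge => N; near=> j; apply: leq_trans (hP j).1.
  by near: j; exact: nbhs_infty_ge.
apply/subr_cvg0; apply: (cvg0_eunorm_le _ cvg_harmonic); near=> j.
exact: ltW (hP j).2.
Unshelve. all: by end_near. Qed.

End Compactness.

Section Distance.
Variables (R : realType) (k : nat).
Implicit Types (A : set 'rV[R]_k) (x y a : 'rV[R]_k).

Lemma setdist_le x a A : A a -> setdist x A <= eunorm (x - a).
Proof.
move=> Aa; apply: ge_inf; last by exists a.
by exists 0 => _ [b _ <-]; exact: eunorm_ge0.
Qed.

Lemma setdist_ge x A (e : R) : A !=set0 ->
  (forall a, A a -> e <= eunorm (x - a)) -> e <= setdist x A.
Proof.
move=> [a Aa] xA; apply: lb_le_inf; first by exists (eunorm (x - a)), a.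
by move=> _ [b Ab <-]; exact: xA.
Qed.

Lemma setdist_ge0 x A : A !=set0 -> 0 <= setdist x A.
Proof. by move=> A0; apply: setdist_ge. Qed.

Lemma setdist_mem x A : A x -> setdist x A = 0.
Proof.
move=> Ax; apply/eqP; rewrite eq_le setdist_ge0 ?andbT; last by exists x.
by apply: le_trans (setdist_le x Ax) _; rewrite subrr eunorm0.
Qed.

Lemma setdist_lt x A (e : R) : A !=set0 -> setdist x A < e ->
  exists2 a, A a & eunorm (x - a) < e.
Proof.
move=> A0; apply: contraPP => /forall2NP xA; apply/negP; rewrite -leNgt.
by apply: setdist_ge => // a Aa; case: (xA a) => // /negP; rewrite -leNgt.
Qed.

Lemma setdist_leD x y A : A !=set0 -> setdist x A <= eunorm (x - y) + setdist y A.
Proof.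
move=> A0; rewrite -lerBlDl; apply: setdist_ge => // a Aa.
rewrite lerBlDl; apply: le_trans (eunorm_distD y _ _); exact: setdist_le.
Qed.

Lemma continuous_setdist A : A !=set0 -> continuous (fun x => setdist x A).
Proof.
move=> A0 x; apply/(@cvgrPdist_lt _ _ _ (nbhs x)) => e e0.
near=> y; have yx : eunorm (y - x) < e by near: y; exact: nbhs_eunorm_lt.
have := setdist_leD x y A0; have := setdist_leD y x A0.
by rewrite (eunorm_distC x) ltr_norml => ? ?; apply/andP; split; lra.
Unshelve. all: by end_near. Qed.

Lemma nearest_point x A : closed A -> A !=set0 ->
  exists2 p, A p & setdist x A = eunorm (x - p).
Proof.
move=> Acl [a Aa].
have [||p Ap pmin] := coercive_min (M := eunorm x + eunorm (x - a)) _ Acl Aa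
    (F := fun y => eunorm (x - y)).
- move=> y; apply: (@cvg_eunorm _ _ (nbhs y) _ _ (fun z => x - z)).
  by apply: cvgB; [exact: cvg_cst|exact: cvg_id].
- move=> y _ ya; apply: le_trans (_ : eunorm (x + (y - x)) <= _).
    by rewrite addrC subrK.
  by apply: le_trans (eunormD_le _ _) _; rewrite lerD2l eunorm_distC.
exists p => //; apply/eqP; rewrite eq_le setdist_le //=.
by apply: setdist_ge => //; exists a.
Qed.

Lemma eunorm_min_dotv_le0 x y :
  (forall t : R, 0 <= t <= 1 -> eunorm x <= eunorm (x - t *: y)) -> dotv x y <= 0.
Proof.
move=> xmin; have bound j : 2 * dotv x y <= harmonic j * eunorm y ^+ 2.
  have hj0 : 0 < harmonic j :> R := harmonic_gt0 j.
  have hj1 : harmonic j <= 1 :> R by rewrite invf_le1 ?ltr0n // ler1n.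
  have := xmin (harmonic j); rewrite (ltW hj0) hj1 => /(_ isT).
  rewrite -ler_sqr ?nnegrE // -scaleNr eunormD_sqr dotvZr eunormZ exprMn.
  by rewrite (real_normK (num_real _)) => ?; rewrite -(ler_pM2l hj0); lra.
have cvg0 : harmonic j * eunorm y ^+ 2 @[j --> \oo] --> 0.
  by rewrite -(mul0r (eunorm y ^+ 2)); apply: cvgMr_tmp; exact: cvg_harmonic.
by rewrite -(pmulr_rle0 _ (ltr0n R 2)); apply: (cvgr_to_ge cvg0); exact: nearW.
Qed.

End Distance.

(** * Differential calculus *)

Lemma scale_subr_coord (R : realType) k (s : R) (u v : 'rV[R]_k) i :
  (s *: (u - v)) 0 i = s * (u 0 i - v 0 i).
Proof. by rewrite !mxE. Qed.

Section Gradient.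
Variables (R : realType) (n m : nat) (g : 'rV[R]_n -> 'rV[R]_m).
Implicit Types (x d : 'rV[R]_n).

Lemma gradE x d : grad g x d = d *m jacobian g x.
Proof. by rewrite /jacobian mul_rV_lin1. Qed.

Lemma gradZ x a d : grad g x (a *: d) = a *: grad g x d.
Proof. by rewrite !gradE scalemxAl. Qed.

Lemma grad_sum_delta x d : grad g x d = \sum_j d 0 j *: grad g x (delta_mx 0 j).
Proof.
rewrite {1}(matrix_sum_delta d) big_ord1 gradE mulmx_suml.
by apply: eq_bigr => j _; rewrite -scalemxAl -gradE.
Qed.

Lemma grad_quotient_cvg x d : differentiable g x ->
  (fun s : R => s^-1 *: (g (s *: d + x) - g x)) @ 0^' --> grad g x d.
Proof.
by move=> dg; rewrite /grad -deriveE //; exact: (@diff_derivable _ _ _ g x d dg).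
Qed.

Lemma is_derive_path x d (i : 'I_m) (t : R) : differentiable g (x + t *: d) ->
  is_derive t 1 (fun s : R => g (x + s *: d) 0 i) (grad g (x + t *: d) d 0 i).
Proof.
move=> dg; have quotient_cvg : (fun h : R => h^-1 *: (g (x + (h *: 1 + t) *: d) 0 i
    - g (x + t *: d) 0 i)) @ 0^' --> grad g (x + t *: d) d 0 i.
  have /cvg_rowP/(_ i) := grad_quotient_cvg (d := d) dg.
  apply: cvg_trans; apply: near_eq_cvg; apply: nearW => s.
  rewrite scale_subr_coord; congr (_ * (g _ _ _ - _)).
  by rewrite [s *: 1]mulr1 scalerDl addrCA.
by apply: DeriveDef; [apply/cvg_ex; eexists; exact: quotient_cvg|exact: cvg_lim].
Qed.

Lemma grad_mean_value x d (i : 'I_m) : (forall y, differentiable g y) ->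
  exists c : R, 0 <= c <= 1 /\ g (x + d) 0 i - g x 0 i = grad g (x + c *: d) d 0 i.
Proof.
move=> dg; have [|||c] := @MVT_segment R (fun s => g (x + s *: d) 0 i)
  (fun s => grad g (x + s *: d) d 0 i) 0 1.
- exact: ler01.
- by move=> s _; exact: is_derive_path.
- apply: derivable_within_continuous => s _.
  exact: (@ex_derive _ _ _ _ _ _ _ (is_derive_path i (dg (x + s *: d)))).
by rewrite in_itv /= scale1r scale0r addr0 subr0 mulr1 => c01 ->; exists c.
Qed.

End Gradient.

Section TwiceDifferentiable.
Variables (R : realType) (n m : nat) (g : 'rV[R]_n -> 'rV[R]_m).
Hypothesis g_C2 : C2 g.
Implicit Types (x d : 'rV[R]_n).

Lemma C2_differentiable x : differentiable g x.
Proof. by case: g_C2. Qed.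

Lemma C2_continuous : continuous g.
Proof. by move=> x; apply: differentiable_continuous; exact: C2_differentiable. Qed.

Section Filter.
Variables (T : Type) (F : set_system T).
Context {FF : Filter F}.

Lemma cvg_grad (y v : T -> 'rV[R]_n) x d : y @ F --> x -> v @ F --> d ->
  grad g (y p) (v p) @[p --> F] --> grad g x d.
Proof.
move=> yx /cvg_rowP vd; rewrite grad_sum_delta; under eq_cvg do rewrite grad_sum_delta.
apply: cvg_big => [|j _]; first exact: add_continuous.
apply: cvgZ (vd j) _; apply: (cvg_comp y (fun z => grad g z (delta_mx 0 j)) yx).
by case: g_C2 => _ [/(_ (delta_mx 0 j) x) /differentiable_continuous].
Qed.

(* By the mean value theorem, which is applied to each coordinate separately, the
   quotient is a value of the differential, which is jointly continuous. *)
Lemma cvg_strict_quotient (y v : T -> 'rV[R]_n) (s : T -> R) x d :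
  (forall p, s p != 0) -> y @ F --> x -> s @ F --> 0 -> v @ F --> d ->
  (s p)^-1 *: (g (y p + s p *: v p) - g (y p)) @[p --> F] --> grad g x d.
Proof.
move=> s_neq0 yx s0 vd; apply/cvg_rowP => i.
have /choice[c cP] := fun p => grad_mean_value (y p) (s p *: v p) i C2_differentiable.
have quotientE p : ((s p)^-1 *: (g (y p + s p *: v p) - g (y p))) 0 i =
    grad g (y p + (c p * s p) *: v p) (v p) 0 i.
  by have [_ cE] := cP p; rewrite scale_subr_coord cE gradZ scalerA mxE mulKf.
under eq_cvg do rewrite quotientE.
suff cs0 : (c p * s p) @[p --> F] --> 0.
  apply: (cvg_comp _ (fun z : 'rV_m => z 0 i) (cvg_grad _ vd));
    last exact: coord_continuous.
  exact: cvgD_scale0 yx cs0 vd.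
have ns0 : `|s p| @[p --> F] --> 0 by rewrite -(normr0 R); exact: cvg_norm.
apply: (@squeeze_cvgr _ _ _ _ (fun p => - `|s p|) (fun p => `|s p|)) => //.
- apply: nearW => p; rewrite -ler_norml normrM; have [/andP[c0 c1] _] := cP p.
  by rewrite ger0_norm // ler_piMl.
- by rewrite -oppr0; exact: cvgN.
Qed.

End Filter.

Lemma second_order_quotient_cvg x d :
  (2^-1 * t ^+ 2)^-1 *: (g (x + t *: d) - g x - t *: grad g x d) @[t --> 0^'+]
    --> hess2 g x d.
Proof.
apply/cvg_rowP => i.
pose rem (t : R) := g (x + t *: d) 0 i - (g x 0 i + t * grad g x d 0 i).
pose drem (t : R) := grad g (x + t *: d) d 0 i - grad g x d 0 i.
have rem_derive (t : R) : is_derive t 1 rem (drem t).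
  apply: is_deriveB; first by apply: is_derive_path; exact: C2_differentiable.
  by apply: is_derive_eq; rewrite /GRing.scale /=; lra.
have sqr_derive (t : R) : is_derive t 1 (fun s : R => 2^-1 * s ^+ 2) t.
  by apply: is_derive_eq; rewrite /GRing.scale /=; lra.
have at0 (h dh : R -> R) : (forall t : R, is_derive t 1 h (dh t)) -> h 0 = 0 ->
    h t @[t --> 0^'+] --> 0.
  move=> hd h0; rewrite -[X in _ --> X]h0; apply: cvg_at_right_filter.
  have [/derivable1_diffP/differentiable_continuous hc _] := hd 0; exact: hc.
have drem_cvg : drem t / t @[t --> 0^'+] --> hess2 g x d 0 i.
  have dd : differentiable (fun y => grad g y d) x by case: g_C2 => _ [dd _]; exact: dd.
  have /cvg_rowP/(_ i) := grad_quotient_cvg (d := d) dd.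
  move=> /cvg_dnbhs_at_right; apply: cvg_trans; apply: near_eq_cvg; near=> t.
  by rewrite scale_subr_coord mulrC (addrC _ x).
have quotientE (t : R) : rem t / (2^-1 * t ^+ 2) =
    ((2^-1 * t ^+ 2)^-1 *: (g (x + t *: d) - g x - t *: grad g x d)) 0 i.
  rewrite /rem; move: (g (x + _)) (g x) (grad g x d) (2^-1 * _) => u v w s.
  by rewrite !mxE mulrC opprD addrA.
under eq_cvg do rewrite -quotientE.
apply: (@lhopital_at_right R rem drem (fun s => 2^-1 * s ^+ 2) id 0 1 _ ltr01
  (fun t _ => rem_derive t) (fun t _ => sqr_derive t)) => //.
- by apply: at0 rem_derive _; rewrite /rem scale0r addr0 mul0r addr0 subrr.
- by apply: at0 sqr_derive _; rewrite expr0n mulr0.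
- by move=> t; rewrite in_itv /= => /andP[/gt_eqF ->].
Unshelve. all: by end_near. Qed.

End TwiceDifferentiable.

(** * Step sizes and directional neighborhoods *)

Section DirectionalNeighborhoods.
Variables (R : realType) (k : nat).
Implicit Types (t : nat -> R) (d : 'rV[R]_k).

Lemma down0_at_right t : down0 t -> t @ \oo --> 0^'+.
Proof.
move=> [t_gt0 t0] A A0.
by apply: (@filterS _ \oo _ _ _ _ (t0 _ A0)) => j; apply; exact: t_gt0.
Qed.

Lemma down0_le_harmonic t : (forall j, 0 < t j <= j.+1%:R^-1) -> down0 t.
Proof.
move=> tP; split=> [j|]; first by case/andP: (tP j).
apply: (@squeeze_cvgr _ _ _ _ (cst 0) harmonic); last exact: cvg_harmonic.
  by apply: nearW => j; case/andP: (tP j) => /ltW ->.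
exact: cvg_cst.
Qed.

Lemma down0_subseq t (h : nat -> nat) : down0 t -> h @ \oo --> \oo -> down0 (t \o h).
Proof. by move=> [t_gt0 t0] hy; split=> [j|]; [exact: t_gt0|exact: cvg_comp t0]. Qed.

Lemma near_dirP (P : R -> 'rV[R]_k -> Prop) d :
  (\forall t \near 0^'+ & v \near d, P t v) <->
  exists2 r : R, 0 < r & forall (t : R) v, 0 < t -> t < r -> eunorm (v - d) < r -> P t v.
Proof.
split=> [[[A B] /= [/nbhs_ballP[a /= a0 A0] /nbhs_ballP[b /= b0 Bd]] ABP]|[r r0 rP]].
  exists (Num.min a b); first by rewrite lt_min a0.
  move=> t v t0; rewrite !lt_min => /andP[ta _] /andP[_ vd].
  apply: (ABP (t, v)); split=> /=.
    by apply: (A0 t) => //; rewrite /ball /= sub0r normrN gtr0_norm.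
  apply: (Bd v); rewrite mx_norm_ball /ball_ /= distrC.
  exact: le_lt_trans (norm_le_eunorm _) vd.
exists ([set t : R | 0 < t < r], [set v | eunorm (v - d) < r]).
  split; last exact: nbhs_eunorm_lt.
  by near=> t; apply/andP; split.
by move=> [t v] [/= /andP[t0 tr] vd]; exact: rP.
Unshelve. all: by end_near. Qed.

Lemma near_dir_seq (P : R -> 'rV[R]_k -> Prop) t (v : nat -> 'rV[R]_k) d :
  (\forall t \near 0^'+ & v \near d, P t v) -> down0 t -> v @ \oo --> d ->
  \forall j \near \oo, P (t j) (v j).
Proof. by move=> Pd /down0_at_right t0 vd; exact: (cvg_pair t0 vd) _ Pd. Qed.

Lemma not_near_dir_seq (P : nat -> R -> 'rV[R]_k -> Prop) d :
  (forall j, ~ \forall t \near 0^'+ & v \near d, P j t v) ->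
  exists t, exists v : nat -> 'rV[R]_k,
    [/\ down0 t, v @ \oo --> d & forall j, ~ P j (t j) (v j)].
Proof.
move=> notP.
have /choice[tv tvP] j : exists tv : R * 'rV[R]_k, [/\ 0 < tv.1, tv.1 < j.+1%:R^-1,
    eunorm (tv.2 - d) < j.+1%:R^-1 & ~ P j tv.1 tv.2].
  apply: contrapT => no_tv; apply: (notP j); apply/near_dirP.
  exists j.+1%:R^-1 => // t v t0 tj vj; apply: contrapT => nPtv.
  by apply: no_tv; exists (t, v).
exists (fst \o tv), (snd \o tv); split=> [||j]; last by case: (tvP j).
  by apply: down0_le_harmonic => j /=; case: (tvP j) => -> /ltW ->.
apply/subr_cvg0; apply: (cvg0_eunorm_le _ cvg_harmonic); apply: nearW => j.
by have [_ _ vj _] := tvP j; exact: ltW.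
Qed.

End DirectionalNeighborhoods.

(** * Tangent and normal cones *)

Section Cones.
Variables (R : realType) (k : nat).
Implicit Types (A K : set 'rV[R]_k) (x y u v d z p : 'rV[R]_k).

Definition convex_cone A : Prop := [/\ A 0, forall u v, A u -> A v -> A (u + v) &
  forall (c : R) v, 0 <= c -> A v -> A (c *: v)].

Definition polar A : set 'rV[R]_k := [set v | forall l, A l -> dotv l v <= 0].

Lemma Tcone0 A x : A x -> Tcone A x 0.
Proof.
move=> Ax; exists harmonic, (fun=> 0); split; last split.
- by apply: down0_le_harmonic => j; rewrite harmonic_gt0 /=.
- exact: cvg_cst.
- by move=> j; rewrite scaler0 addr0.
Qed.

(* Comparing squared distances from [x + tau *: p] to [x] and to [x + t j *: ds j]
   bounds [dotv p (ds j)] by a multiple of [t j]. *)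
Lemma NPcone_polar_Tcone A x p : NPcone A x p -> polar (Tcone A x) p.
Proof.
move=> [_ [tau [tau0 near_x]]] d [t [ds [[t_gt0 t0] [dsd Ads]]]].
have bound j : 2 * tau * dotv (ds j) p <= t j * eunorm (ds j) ^+ 2.
  have := near_x _ (Ads j); rewrite -ler_sqr ?nnegrE //.
  have -> : x + tau *: p - (x + t j *: ds j) = tau *: p + - t j *: ds j by vector_ring.
  rewrite addrAC subrr add0r eunormD_sqr dotvZl dotvZr (dotvC p) !eunormZ !exprMn.
  by rewrite !(real_normK (num_real _)) => ?; rewrite -(ler_pM2l (t_gt0 j)); lra.
rewrite -(pmulr_rle0 _ (mulr_gt0 (ltr0n R 2) tau0)).
rewrite -(mul0r (eunorm d ^+ 2)).
apply: (@ler_cvg_to _ \oo _ _ (fun j => 2 * tau * dotv (ds j) p)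
  (fun j => t j * eunorm (ds j) ^+ 2)).
- by apply: cvgM; [exact: cvg_cst|apply: cvg_dotv => //; exact: cvg_cst].
- by apply: cvgM => //; rewrite expr2; apply: cvgM; exact: cvg_eunorm.
- exact: nearW.
Qed.

(* Half the squared distance to [z] is differentiable with gradient [p - z] at [p]. *)
Lemma nearest_Fnormal K z p : K p ->
  (forall q, K q -> eunorm (z - p) <= eunorm (z - q)) -> Fnormal K p (z - p).
Proof.
move=> Kp zp; split=> // e e0; exists e; split=> // q Kq qpe.
have := zp q Kq; rewrite -ler_sqr ?nnegrE //.
have -> : z - q = (z - p) + (p - q) by vector_ring.
rewrite (eunormD_sqr (z - p)) -(opprB q p) dotvNr opprB (eunorm_distC p) => ?.
have : eunorm (q - p) * eunorm (q - p) <= e * eunorm (q - p).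
  by apply: ler_wpM2r => //; exact: ltW.
have : 0 <= e * eunorm (q - p) by rewrite mulr_ge0 // ltW.
lra.
Qed.

Lemma FnormalZ K p v (c : R) : 0 <= c -> Fnormal K p v -> Fnormal K p (c *: v).
Proof.
rewrite le_eqVlt => /predU1P[<- [Kp _]|c0 [Kp vP]]; split=> // e e0.
  by exists 1; split=> // q _ _; rewrite scale0r dotv0l mulr_ge0 // ltW.
have [r [r0 rP]] := vP _ (divr_gt0 e0 c0); exists r; split=> // q Kq qr.
by rewrite dotvZl mulrC -ler_pdivlMr // mulrAC; exact: rP.
Qed.

Lemma Ndir0 K y u : Tcone K y u -> Ndir K y u 0.
Proof.
move=> [t [us [dt [usu Kus]]]]; exists t, us, (fun=> 0); split=> //; split=> //.
split; first exact: cvg_cst.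
move=> j; split=> // e e0; exists 1; split=> // q _ _.
by rewrite dotv0l mulr_ge0 // ltW.
Qed.

Lemma NdirZ K y u v (c : R) : 0 <= c -> Ndir K y u v -> Ndir K y u (c *: v).
Proof.
move=> c0 [t [us [vs [dt [usu [vsv vsF]]]]]].
exists t, us, (fun j => c *: vs j); split=> //; split=> //; split.
  exact: cvgZl_tmp.
by move=> j; exact: FnormalZ.
Qed.

Lemma Ndir_unit_limit K y u (t : nat -> R) (us ls : nat -> 'rV[R]_k) :
  down0 t -> us @ \oo --> u -> (forall j, Fnormal K (y + t j *: us j) (ls j)) ->
  (forall j, ls j != 0) ->
  exists h : nat -> nat, exists l : 'rV[R]_k, [/\ h @ \oo --> \oo,
    (fun j => (eunorm (ls (h j)))^-1 *: ls (h j)) @ \oo --> l, Ndir K y u l &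
    eunorm l = 1].
Proof.
move=> dt usu lsF ls_neq0; pose nu j := (eunorm (ls j))^-1 *: ls j.
have nu1 j : eunorm (nu j) = 1 by exact: eunorm_normalize.
have [|h [l hy nul]] := @bounded_subseq _ _ nu 1.
  by apply: nearW => j; rewrite nu1.
exists h, l; split=> //; last first.
  apply: (cvg_unique _ (cvg_eunorm nul)) => //=.
  by under eq_cvg do rewrite nu1; exact: cvg_cst.
exists (t \o h), (us \o h), (nu \o h); split; first exact: down0_subseq.
split; first exact: (cvg_comp h us hy usu).
split=> [//|j]; apply: FnormalZ (lsF (h j)).
by rewrite invr_ge0.
Qed.

End Cones.

Section ConvexCones.
Variables (R : realType) (k : nat).
Implicit Types (A K : set 'rV[R]_k) (u v y : 'rV[R]_k).

Lemma sub_convhull A : A `<=` convhull A.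
Proof.
move=> v Av; exists 1%N, (fun=> v), (fun=> 1); split=> //; split=> //.
by rewrite !big_ord1 scale1r.
Qed.

Lemma convhullZ A v (c : R) : (forall w, A w -> A (c *: w)) ->
  convhull A v -> convhull A (c *: v).
Proof.
move=> cA [p [a [l [Aa [l0 [l1 ->]]]]]].
exists p, (fun i => c *: a i), l; split; first by move=> i; exact: cA.
split=> //; split=> //; rewrite scaler_sumr; apply: eq_bigr => i _.
by rewrite !scalerA mulrC.
Qed.

(* The sum of two convex combinations is the midpoint of their doubles. *)
Lemma convhullD A u v : (forall (c : R) w, 0 <= c -> A w -> A (c *: w)) ->
  convhull A u -> convhull A v -> convhull A (u + v).
Proof.
move=> coneA [p [a [l [Aa [l0 [l1 ->]]]]]] [q [b [r [Ab [r0 [r1 ->]]]]]].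
pose glue T (fa : 'I_p -> T) (fb : 'I_q -> T) (i : 'I_(p + q)) :=
  match fintype.split i with inl j => fa j | inr j => fb j end.
have glue_l T fa fb i : glue T fa fb (lshift q i) = fa i.
  by rewrite /glue -/(unsplit (inl i)) unsplitK.
have glue_r T fa fb i : glue T fa fb (rshift p i) = fb i.
  by rewrite /glue -/(unsplit (inr i)) unsplitK.
exists (p + q)%N, (glue _ (fun j => 2 *: a j) (fun j => 2 *: b j)),
  (glue _ (fun j => 2^-1 * l j) (fun j => 2^-1 * r j)).
have two_half (c : R) (w : 'rV[R]_k) : (2^-1 * c) *: (2 *: w) = c *: w.
  by rewrite scalerA mulrAC mulVf ?mul1r.
split; last split; last split.
- by move=> i; rewrite /glue; case: fintype.split => j; exact: coneA.
- by move=> i; rewrite /glue; case: fintype.split => j; rewrite mulr_ge0 ?invr_ge0.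
- rewrite big_split_ord /=; under eq_bigr do rewrite glue_l.
  under [X in _ + X]eq_bigr do rewrite glue_r.
  by rewrite -!mulr_sumr l1 r1; lra.
- rewrite big_split_ord /=; congr (_ + _); apply: eq_bigr => i _.
    by rewrite !glue_l two_half.
  by rewrite !glue_r two_half.
Qed.

Lemma closure_convex_cone A : convex_cone A -> convex_cone (closure A).
Proof.
move=> [A0 AD AZ].
have addc : continuous (fun w : 'rV[R]_k * 'rV[R]_k => w.1 + w.2).
  exact: add_continuous.
split=> [|u v clu clv B|c v c0 clv B].
- exact: subset_closure.
- move=> /(addc (u, v))[[P Q] [/= /clu[a [Aa Pa]] /clv[b [Ab Qb]]] PQ].
  by exists (a + b); split; [exact: AD|exact: (PQ (a, b))].
- have cvgZ_id : (c \*: id) @ nbhs v --> c *: v by apply: cvgZl_tmp; exact: cvg_id.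
  by move=> /cvgZ_id/clv[a [Aa Ba]]; exists (c *: a); split; [exact: AZ|].
Qed.

Lemma NCdir_convex_cone K y u : Tcone K y u -> convex_cone (NCdir K y u).
Proof.
move=> Tu; apply: closure_convex_cone; split=> [|v w|c v c0].
- by apply: sub_convhull; exact: Ndir0.
- by apply: convhullD => c z c0; exact: NdirZ.
- by apply: convhullZ => w; exact: NdirZ.
Qed.

Lemma Ndir_sub_NCdir K y u : Ndir K y u `<=` NCdir K y u.
Proof. exact: subset_trans (@sub_convhull _) (@subset_closure _ _). Qed.

End ConvexCones.

Section ClarkeTangents.
Variables (R : realType) (k : nat).
Implicit Types (K : set 'rV[R]_k) (y u v : 'rV[R]_k).

Lemma polar_Ndir_Fnormal_le K y u v (e : R) : polar (Ndir K y u) v -> 0 < e ->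
  \forall t \near 0^'+ & u' \near u,
    forall l, Fnormal K (y + t *: u') l -> dotv l v <= e * eunorm l.
Proof.
move=> Nv e0; apply: contrapT => not_near.
have [t [us [dt usu /= tusP]]] := not_near_dir_seq (fun=> not_near).
have /choice[ls lsP] j : exists l, Fnormal K (y + t j *: us j) l /\
    e * eunorm l < dotv l v.
  apply: contrapT => no_l; apply: (tusP j) => l Fl; rewrite leNgt; apply/negP => el.
  by apply: no_l; exists l.
have ls_neq0 j : ls j != 0.
  by apply/eqP => lj0; have := (lsP j).2; rewrite lj0 dotv0l eunorm0 mulr0 ltxx.
have [h [l [_ lsl Nl _]]] := Ndir_unit_limit dt usu (fun j => (lsP j).1) ls_neq0.
suff : e <= dotv l v by rewrite leNgt (le_lt_trans (Nv l Nl) e0).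
apply: (cvgr_to_ge (cvg_dotv lsl (cvg_cst v))); apply: nearW => j.
rewrite dotvZl mulrC ler_pdivlMr ?eunorm_gt0 //.
exact: ltW (lsP (h j)).2.
Qed.

(* The squared distance to [K] grows at rate at most [2 * e] times the distance, up to
   the second-order error [h ^+ 2 * eunorm v ^+ 2]. *)
Lemma setdist_step_le K y p v (e h M : R) : K p -> setdist y K = eunorm (y - p) ->
  dotv (y - p) v <= e * eunorm (y - p) -> 0 < e -> 0 < h -> setdist y K <= M ->
  h * eunorm v ^+ 2 <= 2 * e * M -> setdist (y + h *: v) K <= M + 2 * e * h.
Proof.
move=> Kp distE slope e0 h0; rewrite distE => pM h_small.
have M0 : 0 <= M by exact: le_trans pM.
have eh0 : 0 < e * h by rewrite mulr_gt0.
apply: le_trans (setdist_le _ Kp) _; rewrite addrAC.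
rewrite -ler_sqr ?nnegrE //; last lra.
rewrite (eunormD_sqr (y - p)) dotvZr eunormZ gtr0_norm // exprMn.
have : eunorm (y - p) ^+ 2 <= M ^+ 2 by rewrite ler_sqr ?nnegrE.
have : h * dotv (y - p) v <= h * (e * eunorm (y - p)) by rewrite ler_pM2l.
have : e * h * eunorm (y - p) <= e * h * M by rewrite ler_pM2l.
have : h * (h * eunorm v ^+ 2) <= h * (2 * e * M) by rewrite ler_pM2l.
have := sqr_ge0 (e * h).
lra.
Qed.

(* On a fine enough uniform subdivision of [0, s], the distance from [y + c *: v] to [K]
   stays below [e * (s + 2 * c)]. *)
Lemma setdist_segment_le K y v (e s : R) : closed K -> K y -> 0 < e -> 0 < s ->
  (forall (c : R) p, 0 <= c -> c <= s -> K p ->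
     setdist (y + c *: v) K = eunorm (y + c *: v - p) ->
     dotv (y + c *: v - p) v <= e * eunorm (y + c *: v - p)) ->
  setdist (y + s *: v) K <= 3 * (e * s).
Proof.
move=> Kcl Ky e0 s0 slope; have K0 : K !=set0 by exists y.
have [N Nlarge] : exists N : nat, eunorm v ^+ 2 / (2 * e ^+ 2) < N.+1%:R.
  by exists (Num.truncn (eunorm v ^+ 2 / (2 * e ^+ 2))); exact: truncnS_gt.
pose h := s / N.+1%:R.
have h0 : 0 < h by rewrite divr_gt0 ?ltr0n.
have h_small : h * eunorm v ^+ 2 <= 2 * e * (e * s).
  rewrite /h mulrAC ler_pdivrMr ?ltr0n //.
  move: Nlarge; rewrite ltr_pdivrMr ?mulr_gt0 ?exprn_gt0 // => /ltW.
  by rewrite -(ler_pM2l s0); lra.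
have subdivision i : (i <= N.+1)%N ->
    setdist (y + (i%:R * h) *: v) K <= e * s + 2 * e * (i%:R * h).
  elim: i => [_|i IHi iN].
    rewrite mul0r scale0r mulr0 !addr0 setdist_mem //.
    by rewrite mulr_ge0 ?ltW.
  have c0 : 0 <= i%:R * h by rewrite mulr_ge0 // ltW.
  have cs : i%:R * h <= s.
    rewrite /h mulrCA; apply: (ler_piMr (ltW s0)).
    by rewrite ler_pdivrMr ?ltr0n // mul1r ler_nat ltnW.
  have [p Kp distE] := nearest_point (y + (i%:R * h) *: v) Kcl K0.
  have slope_p := slope _ p c0 cs Kp distE.
  rewrite -natr1 mulrDl mul1r scalerDl addrA (mulrDr (2 * e)) addrA.
  apply: (setdist_step_le Kp distE slope_p e0 h0 (IHi (ltnW iN))).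
  have := mulr_ge0 (mulr_ge0 (ltW e0) (ltW e0)) c0.
  lra.
have := subdivision N.+1 (leqnn _).
have -> : N.+1%:R * h = s by rewrite /h mulrC divfK // pnatr_eq0.
lra.
Qed.

Lemma eunorm_nearest_ray_le K y v p (c : R) : K y -> 0 <= c ->
  setdist (y + c *: v) K = eunorm (y + c *: v - p) ->
  eunorm (p - y) <= 2 * (c * eunorm v).
Proof.
move=> Ky c0 distE.
have cvE : eunorm (y + c *: v - y) = c * eunorm v.
  by rewrite addrAC subrr add0r eunormZ ger0_norm.
have := setdist_le (y + c *: v) Ky; rewrite distE cvE.
by have := eunorm_distD (y + c *: v) p y; rewrite cvE (eunorm_distC p (_ + _)); lra.
Qed.

(* Directional form of Clarke's theorem that the polar of the limiting normals consists
   of regular tangents. *)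
Lemma polar_Ndir_setdist_cvg0 K y u v (t s : nat -> R) (us : nat -> 'rV[R]_k) :
  closed K -> polar (Ndir K y u) v -> down0 t -> (forall j, 0 < s j) ->
  s j / t j @[j --> \oo] --> 0 -> us @ \oo --> u -> (forall j, K (y + t j *: us j)) ->
  setdist (y + t j *: us j + s j *: v) K / s j @[j --> \oo] --> 0.
Proof.
move=> Kcl Nv [t_gt0 t0] s_gt0 st0 usu Kus.
have st2v0 : s j / t j * (2 * eunorm v) @[j --> \oo] --> 0.
  by rewrite -(mul0r (2 * eunorm v)); exact: cvgMr_tmp.
apply/cvgrPdist_le => e e0.
have e30 : 0 < e / 3 by rewrite divr_gt0.
have [r r0 slope] := (near_dirP _ _).1 (polar_Ndir_Fnormal_le Nv e30).
have r20 : 0 < r / 2 by rewrite divr_gt0.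
near=> j; set y' := y + t j *: us j.
have tj0 := t_gt0 j; have sj0 := s_gt0 j.
have Ky' : K y' := Kus j; have K0 : K !=set0 by exists y'.
rewrite sub0r normrN ger0_norm; last by rewrite divr_ge0 ?setdist_ge0 ?ltW.
rewrite ler_pdivrMr //; have -> : e * s j = 3 * (e / 3 * s j) by field.
apply: setdist_segment_le => // c p c0 cs Kp distE.
have := slope (t j) ((t j)^-1 *: (p - y)) tj0.
rewrite addr_scale_subK ?gt_eqF //; apply.
- by near: j; apply: (cvgr_lt _ t0).
- have -> : (t j)^-1 *: (p - y) - u = (us j - u) + (t j)^-1 *: (p - y').
    rewrite /y' opprD addrA [in RHS]scalerBr scalerA mulVf ?gt_eqF // scale1r.
    by rewrite [RHS]addrC addrA subrK.
  apply: le_lt_trans (eunormD_le _ _) _; rewrite eunormZ gtr0_norm ?invr_gt0 //.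
  have : eunorm (us j - u) < r / 2 by near: j; exact: cvg_eunorm_lt.
  have : s j / t j * (2 * eunorm v) < r / 2 by near: j; apply: (cvgr_lt _ st2v0).
  have : (t j)^-1 * eunorm (p - y') <= s j / t j * (2 * eunorm v).
    rewrite mulrAC mulrC ler_pM2r ?invr_gt0 //.
    apply: le_trans (eunorm_nearest_ray_le (Kus j) c0 distE) _.
    by rewrite mulrCA ler_wpM2r // mulr_ge0.
  lra.
- apply: nearest_Fnormal => // q Kq; rewrite -distE; exact: setdist_le.
Unshelve. all: by end_near. Qed.

End ClarkeTangents.

(** * Directional metric subregularity *)

Lemma ekeland (R : realType) (n : nat) (phi : 'rV[R]_n -> R) (x : 'rV[R]_n)
    (eta : R) : continuous phi -> (forall y, 0 <= phi y) -> 0 < eta ->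
  exists z, phi z + eta * eunorm (z - x) <= phi x /\
    forall y, phi z <= phi y + eta * eunorm (y - z).
Proof.
move=> phi_c phi0 eta0; pose F y := phi y + eta * eunorm (y - x).
have Fx : F x = phi x by rewrite /F subrr eunorm0 mulr0 addr0.
have Fc : continuous F.
  move=> y; apply: (cvgD (phi_c y)).
  apply: cvgMl_tmp; apply: (cvg_eunorm (F := nbhs y)).
  by apply: cvgB; [exact: cvg_id|exact: cvg_cst].
have [|z _ zmin] := coercive_min (M := eunorm x + phi x / eta) Fc closedT (I : setT x).
  move=> y _; rewrite Fx => yx; rewrite -(subrK x y) addrC.
  apply: le_trans (eunormD_le _ _) _; rewrite lerD2l ler_pdivlMr // mulrC.
  by apply: le_trans yx; rewrite /F lerDr.
exists z; split=> [|y]; first by rewrite -Fx; exact: zmin.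
have := zmin y I; rewrite /F.
have : eta * eunorm (y - x) <= eta * (eunorm (y - z) + eunorm (z - x)).
  by rewrite ler_pM2l //; exact: eunorm_distD.
lra.
Qed.

Section Subregularity.
Variables (R : realType) (n m : nat) (g : 'rV[R]_n -> 'rV[R]_m) (K : set 'rV[R]_m).
Hypotheses (g_C2 : C2 g) (Kcl : closed K).
Implicit Types (x z d h : 'rV[R]_n) (p q : 'rV[R]_m).

Lemma setdist_slope_normal z p (eta : R) : K p -> setdist (g z) K = eunorm (g z - p) ->
  (forall y, setdist (g z) K <= setdist (g y) K + eta * eunorm (y - z)) ->
  forall h, - dotv (g z - p) (grad g z h) <= eta * eunorm (g z - p) * eunorm h.
Proof.
move=> Kp distE slope h; set a := g z - p; pose s j : R := harmonic j.
pose q j := (s j)^-1 *: (g (z + s j *: h) - g z).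
have s_neq0 j : s j != 0 by rewrite gt_eqF // harmonic_gt0.
have s0 : s @ \oo --> 0 := cvg_harmonic.
have qE : q @ \oo --> grad g z h.
  by apply: (@cvg_strict_quotient _ _ _ _ g_C2 _ \oo _ (cst z) (cst h) s) => //;
    exact: cvg_cst.
have bound j : - dotv a (q j) - 2^-1 * s j * eunorm (q j) ^+ 2
    <= eta * eunorm a * eunorm h.
  have sj0 : 0 < s j := harmonic_gt0 j.
  have decrease : eunorm a <= eunorm (a + s j *: q j) + eta * (s j * eunorm h).
    rewrite -distE; apply: le_trans (slope (z + s j *: h)) _; apply: lerD.
      have -> : a + s j *: q j = g (z + s j *: h) - p.
        by rewrite scalerA divff // scale1r addrC addrA subrK.
      exact: setdist_le.
    by rewrite addrC addKr eunormZ gtr0_norm.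
  have sqrE := eunormD_sqr a (s j *: q j).
  rewrite dotvZr eunormZ gtr0_norm // exprMn in sqrE.
  rewrite -(ler_pM2l sj0).
  have := sqr_ge0 (eunorm a - eunorm (a + s j *: q j)).
  have := ler_wpM2l (eunorm_ge0 a) decrease.
  lra.
apply: (@cvgr_to_le _ \oo _ _ (fun j => - dotv a (q j) - 2^-1 * s j * eunorm (q j) ^+ 2)).
  rewrite -[X in _ --> X]subr0; apply: cvgB.
    by apply: cvgN; apply: cvg_dotv => //; exact: cvg_cst.
  rewrite -(mul0r (eunorm (grad g z h) ^+ 2)) -(mulr0 2^-1); apply: cvgM.
    exact: cvgMl_tmp.
  by rewrite expr2; apply: cvgM; exact: cvg_eunorm.
exact: nearW.
Qed.

Lemma ekeland_stationary_point x (c : R) : K !=set0 -> 0 < c ->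
  c * setdist (g x) K < setdist x (g @^-1` K) ->
  exists z p, [/\ K p /\ setdist (g z) K = eunorm (g z - p), g z != p,
    eunorm (g z - p) <= setdist (g x) K, eunorm (z - x) <= c * setdist (g x) K &
    forall h, - dotv (g z - p) (grad g z h) <= c^-1 * eunorm (g z - p) * eunorm h].
Proof.
move=> K0 c0 far; pose phi y := setdist (g y) K.
have phi0 y : 0 <= phi y by exact: setdist_ge0.
have phi_c : continuous phi.
  move=> y; apply: (@continuous_comp _ _ _ g (fun q => setdist q K)).
    exact: C2_continuous.
  exact: continuous_setdist.
have cV0 : 0 < c^-1 by rewrite invr_gt0.
have [z [decrease slope]] := ekeland x phi_c phi0 cV0.
have close : eunorm (z - x) <= c * phi x.
  by rewrite -ler_pdivrMl //; apply: le_trans decrease; rewrite lerDr.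
have [p Kp pE] := nearest_point (g z) Kcl K0.
exists z, p; split=> //.
- apply/eqP => gzp; have Kgz : (g @^-1` K) z by rewrite /= gzp.
  have := lt_le_trans far (setdist_le x Kgz).
  by rewrite eunorm_distC ltNge close.
- by rewrite -pE; apply: le_trans decrease; rewrite lerDl mulr_ge0 // ltW.
- exact: setdist_slope_normal.
Qed.

(* Gfrerer's first-order sufficient condition for metric subregularity in a direction. *)
Definition FOSCMS x d : Prop := forall l, Ndir K (g x) (grad g x d) l ->
  (forall h, dotv l (grad g x h) = 0) -> l = 0.

Section Direction.
Variables x d : 'rV[R]_n.
Hypotheses (Kgx : K (g x)) (foscms : FOSCMS x d).

Lemma FOSCMS_no_stationary_seq (t eta : nat -> R) (z : nat -> 'rV[R]_n)
    (p : nat -> 'rV[R]_m) :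
  down0 t -> eta @ \oo --> 0 -> (fun j => (t j)^-1 *: (z j - x)) @ \oo --> d ->
  (forall j, K (p j) /\ setdist (g (z j)) K = eunorm (g (z j) - p j)) ->
  (forall j, g (z j) != p j) ->
  (fun j => (t j)^-1 *: (p j - g (z j))) @ \oo --> (0 : 'rV[R]_m) ->
  ~ (forall j h, - dotv (g (z j) - p j) (grad g (z j) h) <=
     eta j * eunorm (g (z j) - p j) * eunorm h).
Proof.
move=> dt eta0 vd pP gz_neq pgz stationary; have [t_gt0 t0] := dt.
have t_neq0 j : t j != 0 by rewrite gt_eqF.
pose v j := (t j)^-1 *: (z j - x).
have zE : z = fun j => x + t j *: v j by apply/funext => j; rewrite addr_scale_subK.
have zx : z @ \oo --> x by rewrite zE; exact: cvgD_scale0 (cvg_cst x) t0 vd.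
pose us j := (t j)^-1 *: (p j - g x); pose ls j := g (z j) - p j.
have us_grad : us @ \oo --> grad g x d.
  rewrite -[X in _ --> X]add0r.
  have -> : us = fun j => (t j)^-1 *: (p j - g (z j)) + (t j)^-1 *: (g (z j) - g x).
    by apply/funext => j; rewrite /us -scalerDr addrA subrK.
  apply: cvgD => //.
  rewrite zE; apply: (cvg_strict_quotient g_C2 (y := cst x)) => //; exact: cvg_cst.
have [||h [l [hy lsl Nl l1]]] :=
    Ndir_unit_limit (K := K) (y := g x) (ls := ls) dt us_grad.
- move=> j; rewrite addr_scale_subK //; have [Kp distE] := pP j.
  by apply: nearest_Fnormal => // q Kq; rewrite -distE; exact: setdist_le.
- by move=> j; rewrite subr_eq0; exact: gz_neq.
have grad_le0 w : - dotv l (grad g x w) <= 0.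
  rewrite -(mul0r (eunorm w)).
  apply: (@ler_cvg_to _ \oo _ _
    (fun j => - dotv ((eunorm (ls (h j)))^-1 *: ls (h j)) (grad g (z (h j)) w))
    (fun j => eta (h j) * eunorm w)).
  - apply: cvgN; apply: cvg_dotv => //; apply: cvg_grad => //; last exact: cvg_cst.
    exact: (cvg_comp h z hy zx).
  - by apply: cvgMr_tmp; exact: (cvg_comp h eta hy eta0).
  - apply: nearW => j; rewrite dotvZl -mulrN mulrC ler_pdivrMr.
      by rewrite -mulrA (mulrC (eunorm w)) mulrA; exact: stationary.
    by rewrite eunorm_gt0 subr_eq0; exact: gz_neq.
suff l0 : l = 0 by move: l1; rewrite l0 eunorm0 => /esym/eqP; rewrite oner_eq0.
apply: foscms Nl _ => w; apply/eqP; rewrite eq_le -oppr_le0 grad_le0 andbT.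
by have := grad_le0 (-1 *: w); rewrite gradZ dotvZr mulN1r opprK.
Qed.

(* If subregularity failed, it would fail with each constant [j.+1 ^+ 2] at some point
   [x + t j *: v j].  Ekeland's principle with slope [j.+1^-1] then moves this point by
   [o (t j)] only, hence keeps its asymptotic direction [d]. *)
Lemma directional_subregularity : exists c : R, \forall t \near 0^'+ & v \near d,
  setdist (x + t *: v) (g @^-1` K) <= c * setdist (g (x + t *: v)) K.
Proof.
apply: contrapT => no_c.
have no_sqr_c j : ~ \forall t \near 0^'+ & v \near d, setdist (x + t *: v) (g @^-1` K) <=
    j.+1%:R ^+ 2 * setdist (g (x + t *: v)) K.
  by move=> near_c; apply: no_c; exists (j.+1%:R ^+ 2).
have [t [v [dt vd fail]]] := not_near_dir_seq no_sqr_c; have [t_gt0 _] := dt.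
have K0 : K !=set0 by exists (g x).
pose xs j := x + t j *: v j; pose dist j := setdist (g (xs j)) K.
have dist0 j : 0 <= dist j by exact: setdist_ge0.
have far j : j.+1%:R * (j.+1%:R * dist j) < setdist (xs j) (g @^-1` K).
  by rewrite mulrA -expr2 ltNge; apply/negP; exact: fail.
have S_gt0 j : 0 < j.+1%:R :> R by rewrite ltr0n.
have leS j (a : R) : 0 <= a -> a <= j.+1%:R * a by move=> a0; rewrite ler_peMl // ler1n.
have /choice[z /choice[p zpP]] := fun j => ekeland_stationary_point K0 (S_gt0 j)
  (le_lt_trans (leS j _ (mulr_ge0 (ltW (S_gt0 j)) (dist0 j))) (far j)).
have ratio j (a : R) : a <= j.+1%:R * dist j -> (t j)^-1 * a <= harmonic j * eunorm (v j).
  move=> aj; rewrite ler_pdivrMl // mulrCA ler_pdivlMl //.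
  apply: le_trans (_ : j.+1%:R * (j.+1%:R * dist j) <= _); first by rewrite ler_pM2l.
  apply: le_trans (ltW (far j)) _; apply: le_trans (setdist_le _ Kgx) _.
  by rewrite /xs addrAC subrr add0r eunormZ gtr0_norm.
have hv0 : harmonic j * eunorm (v j) @[j --> \oo] --> 0.
  rewrite -(mul0r (eunorm d)); apply: cvgM; [exact: cvg_harmonic|exact: cvg_eunorm].
apply: (FOSCMS_no_stationary_seq dt cvg_harmonic (z := z) (p := p)) => [|j|j||j h].
- have -> : (fun j => (t j)^-1 *: (z j - x)) =
      fun j => (t j)^-1 *: (z j - xs j) + v j.
    apply/funext => j; rewrite /xs opprD addrA (scalerBr _ (z j - x)).
    by rewrite scalerA mulVf ?gt_eqF // scale1r subrK.
  rewrite -[X in _ --> X]add0r; apply: cvgD vd; apply: cvg0_eunorm_le hv0.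
  apply: nearW => j; rewrite eunormZ gtr0_norm ?invr_gt0 //.
  by apply: ratio; case: (zpP j).
- by case: (zpP j).
- by case: (zpP j).
- apply: cvg0_eunorm_le hv0; apply: nearW => j; rewrite eunormZ gtr0_norm ?invr_gt0 //.
  apply: ratio; rewrite eunorm_distC; have [_ _ pz _ _] := zpP j.
  exact: le_trans pz (leS j _ (dist0 j)).
- by case: (zpP j) => _ _ _ _; exact.
Qed.

End Direction.
End Subregularity.

(** * Feasible arcs *)

Lemma cvg0_of_ratio (R : realType) (t s : nat -> R) : down0 t ->
  s j / t j @[j --> \oo] --> 0 -> s @ \oo --> 0.
Proof.
move=> [t_gt0 t0] st0; rewrite -(mul0r (0 : R)).
have -> : s = fun j => s j / t j * t j.
  by apply/funext => j; rewrite divfK // gt_eqF.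
exact: (cvgM st0 t0).
Qed.

Lemma half_ratio_cvg0 (R : realType) (t r s : nat -> R) : down0 t -> r @ \oo --> 0 ->
  (forall j, s j = 2^-1 * t j * r j) -> s j / t j @[j --> \oo] --> 0.
Proof.
move=> [t_gt0 _] r0 sE; rewrite -(mulr0 2^-1).
apply: cvg_trans (cvgMl_tmp (a := 2^-1) r0); apply: near_eq_cvg; apply: nearW => j.
by rewrite sE; field; rewrite gt_eqF.
Qed.

Lemma scaler_ratioD (R : realType) k (t s : R) (u v : 'rV[R]_k) : t != 0 ->
  t *: (u + (s / t) *: v) = t *: u + s *: v.
Proof. by move=> t0; rewrite scalerDr scalerA mulrC divfK. Qed.

Lemma cvg_ratioD (R : realType) k (t s : nat -> R) (u v : 'rV[R]_k)
    (vs : nat -> 'rV[R]_k) :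
  s j / t j @[j --> \oo] --> 0 -> vs @ \oo --> v ->
  (fun j => u + (s j / t j) *: vs j) @ \oo --> u.
Proof. by move=> st0 vsv; exact: cvgD_scale0 (cvg_cst u) st0 vsv. Qed.

Lemma arc_expansion (R : realType) (n m : nat) (g : 'rV[R]_n -> 'rV[R]_m)
    (x d z : 'rV[R]_n) (b : 'rV[R]_m) (t s : nat -> R) (zs : nat -> 'rV[R]_n) :
  C2 g -> down0 t -> (forall j, 0 < s j) -> s @ \oo --> 0 -> zs @ \oo --> z ->
  (fun j => (s j)^-1 *: (g (x + t j *: d) - g x - t j *: grad g x d)) @ \oo --> b ->
  (fun j => (s j)^-1 *: (g (x + t j *: d + s j *: zs j) - g x - t j *: grad g x d))
    @ \oo --> grad g x z + b.
Proof.
move=> g_C2 [t_gt0 t0] s_gt0 s0 zsz sb.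
have s_neq0 j : s j != 0 by rewrite gt_eqF.
have xdx : (fun j => x + t j *: d) @ \oo --> x.
  exact: cvgD_scale0 (cvg_cst x) t0 (cvg_cst d).
apply: cvg_trans (cvgD (cvg_strict_quotient g_C2 s_neq0 xdx s0 zsz) sb).
apply: near_eq_cvg; apply: nearW => j.
by rewrite fctE -scalerDr; congr (_ *: _); rewrite !addrA subrK.
Qed.

Section FeasibleArcs.
Variables (R : realType) (n m : nat) (g : 'rV[R]_n -> 'rV[R]_m) (K : set 'rV[R]_m).
Variables (x d : 'rV[R]_n).
Hypotheses (g_C2 : C2 g) (Kcl : closed K) (Kgx : K (g x)).
Hypothesis foscms : FOSCMS g K x d.

Section Step.
Variables (z : 'rV[R]_n) (b w : 'rV[R]_m) (t s : nat -> R) (ws : nat -> 'rV[R]_m).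
Hypothesis zbw_polar : polar (Ndir K (g x) (grad g x d)) (grad g x z + b - w).
Hypotheses (dt : down0 t) (s_gt0 : forall j, 0 < s j).
Hypotheses (st0 : s j / t j @[j --> \oo] --> 0) (wsw : ws @ \oo --> w).
Hypothesis Kws : forall j, K (g x + t j *: grad g x d + s j *: ws j).
Hypothesis sb :
  (fun j => (s j)^-1 *: (g (x + t j *: d) - g x - t j *: grad g x d)) @ \oo --> b.

Let t_neq0 j : t j != 0. Proof. by have [t_gt0 _] := dt; rewrite gt_eqF. Qed.
Let s_neq0 j : s j != 0. Proof. by rewrite gt_eqF. Qed.
Let K0 : K !=set0. Proof. by exists (g x). Qed.

Lemma arc_setdist_cvg0 :
  setdist (g (x + t j *: d + s j *: z)) K / s j @[j --> \oo] --> 0.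
Proof.
pose v := grad g x z + b - w; pose xs j := x + t j *: d + s j *: z.
pose ys j := g x + t j *: grad g x d + s j *: ws j + s j *: v.
have ys_dist : setdist (ys j) K / s j @[j --> \oo] --> 0.
  have us_grad := cvg_ratioD (u := grad g x d) st0 wsw.
  have := polar_Ndir_setdist_cvg0 Kcl zbw_polar dt s_gt0 st0 us_grad.
  under eq_cvg do rewrite scaler_ratioD // addrA.
  by apply=> j; rewrite scaler_ratioD // addrA.
have xs_ys : (fun j => (s j)^-1 *: (g (xs j) - ys j)) @ \oo --> (0 : 'rV[R]_m).
  rewrite -(subrr (grad g x z + b)) -[X in _ - X](subrK w) -/v (addrC v).
  apply: cvg_trans (cvgB
    (arc_expansion g_C2 dt s_gt0 (cvg0_of_ratio dt st0) (cvg_cst z) sb)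
    (cvgD wsw (cvg_cst v))).
  apply: near_eq_cvg; apply: nearW => j.
  rewrite !fctE -[ws j + v](scalerK (s_neq0 j)) -scalerBr (scalerDr (s j)).
  rewrite -/(xs j) /ys; congr (_ *: _).
  move: (g (xs j)) (g x) (t j *: _) (s j *: ws j) (s j *: v) => *; vector_ring.
pose bound j := eunorm ((s j)^-1 *: (g (xs j) - ys j)) + setdist (ys j) K / s j.
have bound0 : bound @ \oo --> 0.
  by have := cvgD (cvg_eunorm xs_ys) ys_dist; rewrite eunorm0 addr0; apply.
apply: (@squeeze_cvgr _ _ _ _ (cst 0) bound) (cvg_cst _) bound0.
apply: nearW => j; rewrite /bound divr_ge0 ?setdist_ge0 ?(ltW (s_gt0 j)) //=.
rewrite eunormZ gtr0_norm ?invr_gt0 // [_^-1 * eunorm _]mulrC -mulrDl.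
rewrite ler_pM2r ?invr_gt0 //.
exact: setdist_leD.
Qed.

Lemma feasible_arc : exists2 zs : nat -> 'rV[R]_n, zs @ \oo --> z &
  forall j, K (g (x + t j *: d + s j *: zs j)).
Proof.
pose xs j := x + t j *: d + s j *: z.
have [c subreg] := directional_subregularity g_C2 Kcl Kgx foscms.
have xs_dist : \forall j \near \oo,
    setdist (xs j) (g @^-1` K) / s j <= c * (setdist (g (xs j)) K / s j).
  apply: filterS (near_dir_seq subreg dt (cvg_ratioD (u := d) st0 (cvg_cst z))) => j.
  by rewrite scaler_ratioD // addrA mulrA ler_pM2r ?invr_gt0.
have Phi_cl : closed (g @^-1` K).
  by apply: preimage_closed Kcl => y _; exact: C2_continuous.
have /choice[a aP] j : exists a, K (g a) /\
    setdist (xs j) (g @^-1` K) = eunorm (xs j - a).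
  by have [|a] := nearest_point (xs j) Phi_cl; [exists x|exists a].
exists (fun j => z + (s j)^-1 *: (a j - xs j)) => [|j].
  rewrite -[X in _ --> X]addr0; apply: cvgD; first exact: cvg_cst.
  have c0 : c * (setdist (g (xs j)) K / s j) @[j --> \oo] --> 0.
    by rewrite -(mulr0 c); apply: cvgMl_tmp; exact: arc_setdist_cvg0.
  apply: cvg0_eunorm_le c0; apply: filterS xs_dist => j; apply: le_trans.
  by rewrite eunormZ gtr0_norm ?invr_gt0 // (aP j).2 eunorm_distC mulrC.
rewrite scalerDr scalerA divff // scale1r addrA -/(xs j) addrC subrK.
by case: (aP j).
Qed.

End Step.
End FeasibleArcs.

(** * Conic duality *)

Section ConicDuality.
Variable R : realType.

Lemma dotv_mulmx n m (J : 'M[R]_(n, m)) (z : 'rV[R]_n) (l : 'rV[R]_m) :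
  dotv l (z *m J) = dotv (l *m J^T) z.
Proof.
have dotv_mx11 k (u v : 'rV[R]_k) : dotv u v = (u *m v^T) 0 0.
  by rewrite mxE; apply: eq_bigr => i _; rewrite mxE.
by rewrite !dotv_mx11 trmx_mul mulmxA.
Qed.

Lemma dotv_row_mx n m (a b : 'rV[R]_n) (u v : 'rV[R]_m) :
  dotv (row_mx a u) (row_mx b v) = dotv a b + dotv u v.
Proof.
rewrite /dotv big_split_ord /=.
by congr (_ + _); apply: eq_bigr => i _; rewrite ?row_mxEl ?row_mxEr.
Qed.

Lemma continuous_mulmxr n m (J : 'M[R]_(n, m)) : continuous (fun l : 'rV[R]_n => l *m J).
Proof.
move=> l; apply/(@cvg_rowP _ _ (nbhs l)) => i; rewrite mxE; under eq_cvg do rewrite mxE.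
apply: cvg_big => [|j _]; first exact: add_continuous.
by apply: cvgMr_tmp; exact: coord_continuous.
Qed.

Lemma dotv_scalar_mx (a : R) (u : 'rV[R]_1) : dotv a%:M u = a * u 0 0.
Proof. by rewrite /dotv big_ord1 mxE mulr1n. Qed.

Lemma closed_lsubmx n m (N : set 'rV[R]_n) :
  closed N -> closed [set l : 'rV[R]_(n + m) | N (lsubmx l)].
Proof.
move=> Ncl; apply: (@preimage_closed _ _ lsubmx) Ncl => l _.
apply/(@cvg_rowP _ _ (nbhs l)) => i; rewrite mxE; under eq_cvg do rewrite mxE.
exact: coord_continuous.
Qed.

Section Farkas.
Variables (n m : nat) (A : 'M[R]_(m, n)) (N : set 'rV[R]_m).
Hypotheses (Ncl : closed N) (Ncone : convex_cone N).
Hypothesis A_inj : forall l, N l -> l *m A = 0 -> l = 0.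

Let N0 : N 0. Proof. by case: Ncone. Qed.
Let ND u v : N u -> N v -> N (u + v). Proof. by case: Ncone => _ + _; apply. Qed.
Let NZ (c : R) v : 0 <= c -> N v -> N (c *: v). Proof. by case: Ncone => _ _; apply. Qed.

Lemma continuous_eunorm_mulmxB (p : 'rV[R]_n) :
  continuous (fun l : 'rV[R]_m => eunorm (l *m A - p)).
Proof.
move=> l; apply: (cvg_eunorm (F := nbhs l)); apply: cvgB; last exact: cvg_cst.
exact: continuous_mulmxr.
Qed.

Lemma cone_mulmx_coercive :
  exists2 c : R, 0 < c & forall l, N l -> c * eunorm l <= eunorm (l *m A).
Proof.
pose U := N `&` [set l | 1 <= eunorm l] `&` [set l | eunorm l <= 1].
have normalize l : N l -> l != 0 -> U ((eunorm l)^-1 *: l).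
  move=> Nl l0; split; last by rewrite /= eunorm_normalize.
  by split; [apply: NZ => //; rewrite invr_ge0|rewrite /= eunorm_normalize].
have Ucl : closed U.
  apply: closedI; last by apply: closed_sublevel; exact: continuous_eunorm.
  apply: closedI => //; under eq_set do rewrite -lerN2.
  by apply: closed_sublevel => l; exact: (cvgN (@continuous_eunorm R m l)).
have [[u Uu]|no_U] := pselect (U !=set0); last first.
  exists 1 => // l Nl; have [->|l0] := eqVneq l 0; first by rewrite mul0mx !eunorm0 mulr0.
  by exfalso; apply: no_U; exists ((eunorm l)^-1 *: l); exact: normalize.
have [|a [[Na a1] _] amin] := coercive_min (M := 1)
    (continuous_eunorm_mulmxB (p := 0)) Ucl Uu.
  by move=> l [].
exists (eunorm (a *m A)).
  rewrite eunorm_gt0; apply: contraTneq a1 => /(A_inj Na) ->.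
  by rewrite eunorm0 -ltNge.
move=> l Nl; have [->|l0] := eqVneq l 0; first by rewrite mul0mx !eunorm0 mulr0.
have := amin _ (normalize l Nl l0); rewrite !subr0 -scalemxAl eunormZ.
by rewrite gtr0_norm ?invr_gt0 ?eunorm_gt0 // mulrC ler_pdivlMr ?eunorm_gt0.
Qed.

(* [A] maps [N] to a closed convex cone; the vector from the projection of [p] onto it
   to [p] separates. *)
Lemma cone_farkas (p : 'rV[R]_n) : (exists2 l, N l & l *m A = p) \/
  (exists q, (forall l, N l -> dotv (l *m A) q <= 0) /\ 0 < dotv p q).
Proof.
have [c c0 coercive] := cone_mulmx_coercive.
have [|l Nl lmin] := coercive_min (M := 2 * eunorm p / c)
    (continuous_eunorm_mulmxB (p := p)) Ncl N0.
  move=> l Nl; rewrite mul0mx sub0r => lp; rewrite ler_pdivlMr // mulrC.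
  apply: le_trans (coercive l Nl) _; have := eunorm_distD p (l *m A) 0.
  by move: lp; rewrite !subr0 -scaleN1r eunormZ normrN1 mul1r; lra.
pose q := p - l *m A.
have first_order mu : (forall t : R, 0 <= t <= 1 -> N (l + t *: mu)) ->
    dotv (mu *m A) q <= 0.
  move=> Nt; rewrite dotvC; apply: eunorm_min_dotv_le0 => t /Nt/lmin.
  by rewrite !(eunorm_distC _ p) mulmxDl -scalemxAl opprD addrA.
have [q0|q_neq0] := eqVneq q 0.
  by left; exists l => //; apply/esym/eqP; rewrite -subr_eq0 -/q q0.
right; exists q; split=> [mu Nmu|].
  by apply: first_order => t /andP[t0 _]; apply: ND => //; exact: NZ.
have lq : dotv (- l *m A) q <= 0.
  apply: first_order => t /andP[_ t1]; rewrite (_ : _ + _ = (1 - t) *: l).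
    by apply: NZ => //; rewrite subr_ge0.
  by vector_ring.
rewrite -(subrK (l *m A) p) -/q dotvDl -sqr_eunorm.
have : 0 < eunorm q ^+ 2 by rewrite exprn_gt0 // eunorm_gt0.
by move: lq; rewrite mulNmx dotvNl; lra.
Qed.

End Farkas.

Section Duality.
Variables (n m : nat) (J : 'M[R]_(n, m)) (N : set 'rV[R]_m).
Hypotheses (Ncl : closed N) (Ncone : convex_cone N).
Hypothesis J_inj : forall l, N l -> l *m J^T = 0 -> l = 0.

(* The cone [N * R+], whose second factor is a slack variable. *)
Definition slack_cone : set 'rV[R]_(m + 1) :=
  [set l | N (lsubmx l)] `&` [set l | 0 <= rsubmx l 0 0].

Lemma slack_cone_closed : closed slack_cone.
Proof.
apply: closedI; first exact: closed_lsubmx.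
under eq_set do rewrite mxE -oppr_le0.
by apply: closed_sublevel => l; exact: (cvgN (@coord_continuous _ _ _ _ _ l)).
Qed.

Lemma slack_cone_convex_cone : convex_cone slack_cone.
Proof.
have [N0 ND NZ] := Ncone.
split=> [|u v [Nu u0] [Nv v0]|a v a0 [Nv v0]].
- by split; rewrite /= linear0 // mxE.
- by split; rewrite /= linearD; [exact: ND|rewrite mxE addr_ge0].
- by split; rewrite /= linearZ; [exact: NZ|rewrite mxE mulr_ge0].
Qed.

Lemma cone_alternative (c : 'rV[R]_n) (b : 'rV[R]_m) (gam : R) :
  (exists l, [/\ N l, l *m J^T = - c & gam <= dotv l b]) \/
  (exists z al, [/\ 0 <= al, forall l, N l -> dotv l (z *m J) + al * dotv l b <= 0 &
     dotv c z < al * gam]).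
Proof.
have [N0 _ _] := Ncone.
pose A : 'M[R]_(m + 1, n + 1) := block_mx J^T b^T 0 (-1)%:M.
have mulA (l : 'rV[R]_m) (r : 'rV[R]_1) :
    row_mx l r *m A = row_mx (l *m J^T) (dotv l b - r 0 0)%:M.
  rewrite mul_row_block mulmx0 addr0; congr row_mx; apply/rowP => i.
  rewrite ord1 !mxE big_ord1 !mxE mulr1n mulrN1; congr (_ - _).
  by apply: eq_bigr => j _; rewrite mxE.
have A_inj l : slack_cone l -> l *m A = 0 -> l = 0.
  move=> [Nl _]; rewrite -{1}(hsubmxK l) mulA -row_mx0 => /eq_row_mx[lJ /rowP/(_ 0)].
  have l0 := J_inj Nl lJ; rewrite l0 dotv0l sub0r [LHS]mxE eqxx mulr1n [RHS]mxE => /eqP.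
  rewrite oppr_eq0 => /eqP r0; rewrite -(hsubmxK l) l0 -row_mx0; congr row_mx.
  by apply/rowP => i; rewrite ord1 r0 mxE.
have [[l [Nl r0]]|[q [Nq pq]]] := cone_farkas slack_cone_closed slack_cone_convex_cone
    A_inj (row_mx (- c) gam%:M).
  rewrite -{1}(hsubmxK l) mulA => /eq_row_mx[lJ /rowP/(_ 0)].
  rewrite [LHS]mxE [RHS]mxE eqxx !mulr1n => <-.
  by left; exists (lsubmx l); split=> //; rewrite lerBlDr lerDl; exact: r0.
move: q Nq pq => q; rewrite -(hsubmxK q); move: (lsubmx q) (rsubmx q) => z al Nq.
rewrite dotv_row_mx dotv_scalar_mx dotvNl => pq.
have slack_le l (r : R) : N l -> 0 <= r ->
    dotv l (z *m J) + (dotv l b - r) * al 0 0 <= 0.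
  move=> Nl r0; have := Nq (row_mx l r%:M).
  rewrite mulA dotv_row_mx dotv_scalar_mx -dotv_mulmx mxE mulr1n; apply.
  by split; [rewrite /= row_mxKl|rewrite /= row_mxKr mxE eqxx mulr1n].
right; exists z, (al 0 0); split=> [|l Nl|].
- by have := slack_le 0 1 N0 ler01; rewrite !dotv0l; lra.
- by have := slack_le l 0 Nl (lexx 0); rewrite subr0 (mulrC (dotv _ _)).
- by lra.
Qed.

Lemma cone_alternative_normalize (c z : 'rV[R]_n) (b : 'rV[R]_m) (gam al : R) :
  0 < al -> (forall l, N l -> dotv l (z *m J) + al * dotv l b <= 0) ->
  dotv c z < al * gam -> exists2 y, polar N (y *m J + b) & dotv c y < gam.
Proof.
move=> al0 zN zc; exists (al^-1 *: z).
  move=> l Nl; rewrite -scalemxAl dotvDr dotvZr -(pmulr_rle0 _ al0).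
  by rewrite mulrDr mulrA mulfV ?gt_eqF // mul1r zN.
by rewrite dotvZr mulrC ltr_pdivrMr // mulrC.
Qed.

(* If the multiplier [al] of the alternative vanishes, [z] is a recession direction,
   to be added to a point [y] with [y *m J + b] in the polar of [N]; such a point
   exists because the first alternative fails for [c = 0], [gam = 1]. *)
Lemma cone_duality (c : 'rV[R]_n) (b : 'rV[R]_m) (gam : R) :
  (exists l, [/\ N l, l *m J^T = - c & gam <= dotv l b]) \/
  (exists2 z, polar N (z *m J + b) & dotv c z < gam).
Proof.
have [|[z [al [al0 zN zc]]]] := cone_alternative c b gam; first by left.
right; have [al_eq0|al_neq0] := eqVneq al 0; last first.
  by apply: cone_alternative_normalize zN zc; rewrite lt_neqAle eq_sym al_neq0.
rewrite al_eq0 mul0r in zc.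
have [[l [Nl lJ]]|[y1 [al1 [_ y1N]]]] := cone_alternative 0 b 1.
  by rewrite oppr0 in lJ; rewrite (J_inj Nl lJ) dotv0l ler10.
rewrite dotv0l mulr1 => al1_gt0.
have [|y yN _] := cone_alternative_normalize (c := c)
    (gam := (dotv c y1 + 1) / al1) al1_gt0 y1N.
  by rewrite mulrC divfK ?gt_eqF // ltrDl.
pose M := (`|dotv c y - gam| + 1) / - dotv c z.
have cz0 : 0 < - dotv c z by rewrite oppr_gt0.
have M0 : 0 < M by rewrite divr_gt0 // ltr_wpDl.
exists (y + M *: z) => [l Nl|].
  have zl : dotv l (z *m J) <= 0 by have := zN l Nl; rewrite al_eq0 mul0r addr0.
  rewrite mulmxDl addrAC dotvDr -scalemxAl dotvZr -[leRHS]addr0 lerD ?yN //.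
  by rewrite pmulr_rle0.
rewrite dotvDr dotvZr.
have : M * - dotv c z = `|dotv c y - gam| + 1 by rewrite divfK ?gt_eqF.
have := ler_norm (dotv c y - gam); lra.
Qed.

End Duality.
End ConicDuality.

(** * Second-order necessary conditions *)

Lemma second_order_quotient_seq (R : realType) (n m : nat) (g : 'rV[R]_n -> 'rV[R]_m)
    (x d : 'rV[R]_n) (t : nat -> R) : C2 g -> down0 t ->
  (fun j => (2^-1 * t j ^+ 2)^-1 *: (g (x + t j *: d) - g x - t j *: grad g x d))
    @ \oo --> hess2 g x d.
Proof.
move=> g_C2 /down0_at_right dt.
exact: (cvg_comp t _ dt (second_order_quotient_cvg g_C2 (d := d))).
Qed.

Lemma asymptotic_quotient_cvg0 (R : realType) (n m : nat) (g : 'rV[R]_n -> 'rV[R]_m)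
    (x d : 'rV[R]_n) (t r : nat -> R) : C2 g -> down0 t -> down0 r ->
  t j / r j @[j --> \oo] --> 0 ->
  (fun j => (2^-1 * t j * r j)^-1 *: (g (x + t j *: d) - g x - t j *: grad g x d))
    @ \oo --> (0 : 'rV[R]_m).
Proof.
move=> g_C2 dt [r_gt0 _] tr0; have [t_gt0 _] := dt.
rewrite -(scale0r (hess2 g x d)).
apply: cvg_trans (cvgZ tr0 (second_order_quotient_seq (x := x) (d := d) g_C2 dt)).
apply: near_eq_cvg; apply: nearW => j; rewrite scalerA; congr (_ *: _).
by field; rewrite !gt_eqF.
Qed.

Section TangentDistance.
Variables (R : realType) (n : nat) (S : set 'rV[R]_n) (x d : 'rV[R]_n).
Hypothesis Sx : S x.
Implicit Types (t q : nat -> R) (u v : nat -> 'rV[R]_n).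

Lemma bounded_directions_Tcone t u (M : R) : down0 t -> (forall j, S (x + t j *: u j)) ->
  (\forall j \near \oo, eunorm (u j) <= M) ->
  exists h : nat -> nat, exists u0 : 'rV[R]_n,
    [/\ h @ \oo --> \oo, (u \o h) @ \oo --> u0 & Tcone S x u0].
Proof.
move=> dt Su /bounded_subseq[h [u0 hy uu0]]; exists h, u0; split=> //.
exists (t \o h), (u \o h); split; first exact: down0_subseq.
by split=> // j; exact: Su.
Qed.

Lemma near_nearest_directions t v : down0 t -> exists u, forall j,
  S (x + t j *: u j) /\ t j * eunorm (v j - u j) <=
    setdist (x + t j *: v j) S + t j * harmonic j.
Proof.
move=> [t_gt0 _]; have S0 : S !=set0 by exists x.
have /choice[a aP] j : exists a, S a /\
    eunorm (x + t j *: v j - a) < setdist (x + t j *: v j) S + t j * harmonic j.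
  have [|a Sa aj] := @setdist_lt _ _ (x + t j *: v j) S
      (setdist (x + t j *: v j) S + t j * harmonic j) S0; last by exists a.
  by rewrite ltrDl mulr_gt0 // harmonic_gt0.
have aE j : x + t j *: ((t j)^-1 *: (a j - x)) = a j.
  by rewrite addr_scale_subK // gt_eqF.
exists (fun j => (t j)^-1 *: (a j - x)) => j; rewrite aE; split; first by case: (aP j).
rewrite -{1}(gtr0_norm (t_gt0 j)) -eunormZ scalerBr -[X in _ - X](addKr x) aE.
by rewrite opprD opprK addrA (addrC _ x); apply: ltW; case: (aP j).
Qed.

Lemma setdist_Tcone_le t v q (M : R) : down0 t -> v @ \oo --> d -> q @ \oo --> M ->
  (\forall j \near \oo, setdist (x + t j *: v j) S <= t j * q j) ->
  setdist d (Tcone S x) <= M.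
Proof.
move=> dt vd qM Sq; have [t_gt0 _] := dt.
have [u uP] := near_nearest_directions v dt.
have qhM : (fun j => q j + harmonic j) @ \oo --> M.
  by rewrite -[X in _ --> X]addr0; apply: cvgD => //; exact: cvg_harmonic.
have vu : \forall j \near \oo, eunorm (v j - u j) <= q j + harmonic j.
  apply: filterS Sq => j Sj; rewrite -(ler_pM2l (t_gt0 j)) mulrDr.
  exact: le_trans (uP j).2 (lerD Sj (lexx _)).
have u_bounded : \forall j \near \oo, eunorm (u j) <= eunorm d + 1 + (M + 1).
  near=> j.
  have : eunorm (v j - u j) <= q j + harmonic j by near: j.
  have : q j + harmonic j < M + 1 by near: j; apply: (cvgr_lt _ qhM); rewrite ltrDl.
  have : eunorm (v j) < eunorm d + 1.
    by near: j; apply: (cvgr_lt _ (cvg_eunorm vd)); rewrite ltrDl.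
  have := eunorm_distD (v j) (u j) 0; rewrite !subr0 (eunorm_distC (u j)).
  lra.
have [h [u0 [hy uu0 Tu0]]] := bounded_directions_Tcone dt (fun j => (uP j).1) u_bounded.
apply: le_trans (setdist_le d Tu0) _.
apply: (@ler_cvg_to _ \oo _ _ (fun j => eunorm (v (h j) - u (h j)))
  (fun j => q (h j) + harmonic (h j))).
- by apply: cvg_eunorm; apply: cvgB => //; exact: (cvg_comp h v hy vd).
- exact: (cvg_comp h _ hy qhM).
- exact: (hy _ vu).
Unshelve. all: by end_near. Qed.

Lemma setdist_Tcone_sqr_le t v q (M : R) : down0 t -> v @ \oo --> d -> q @ \oo --> M ->
  (\forall j \near \oo, setdist (x + t j *: v j) S ^+ 2 <= t j ^+ 2 * q j) ->
  setdist d (Tcone S x) ^+ 2 <= M.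
Proof.
move=> dt vd qM Sq; have [t_gt0 _] := dt.
have M0 : 0 <= M.
  apply: (cvgr_to_ge qM); apply: filterS Sq => j /(le_trans (sqr_ge0 _)).
  by rewrite pmulr_rge0 // exprn_gt0.
have T0 : Tcone S x !=set0 by exists 0; exact: Tcone0.
rewrite -(sqr_sqrtr M0) ler_sqr ?nnegrE ?sqrtr_ge0 ?setdist_ge0 //.
apply: (setdist_Tcone_le dt vd (q := fun j => Num.sqrt (q j))).
  exact: (cvg_comp q Num.sqrt qM (@sqrt_continuous _ _)).
apply: filterS Sq => j /ler_wsqrtr; rewrite sqrtr_sqr sqrtrM ?sqr_ge0 // sqrtr_sqr.
by rewrite !ger0_norm ?setdist_ge0 ?(ltW (t_gt0 j)) //; exists x.
Qed.

End TangentDistance.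

Section Conditions.
Variables (R : realType) (n m : nat).
Variables (f : 'rV[R]_n -> 'rV[R]_1) (g : 'rV[R]_n -> 'rV[R]_m) (K : set 'rV[R]_m).
Variables (x d : 'rV[R]_n).
Hypotheses (f_C2 : C2 f) (g_C2 : C2 g) (Kcl : closed K) (Kgx : K (g x)).
Hypothesis foscms : FOSCMS g K x d.
Hypothesis critical : grad f x d 0 0 <= 0.

Lemma fval_arc (b : 'rV[R]_1) (t s : nat -> R) (z : 'rV[R]_n) (zs : nat -> 'rV[R]_n) :
  down0 t -> (forall j, 0 < s j) -> s @ \oo --> 0 -> zs @ \oo --> z ->
  (fun j => (s j)^-1 *: (f (x + t j *: d) - f x - t j *: grad f x d)) @ \oo --> b ->
  exists q : nat -> R, q @ \oo --> grad f x z 0 0 + b 0 0 /\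
    forall j, fval f (x + t j *: d + s j *: zs j) - fval f x <= s j * q j.
Proof.
move=> dt s_gt0 s0 zsz sb; have [t_gt0 _] := dt.
have /cvg_rowP/(_ 0) := arc_expansion f_C2 dt s_gt0 s0 zsz sb.
rewrite mxE; set q := fun j => _ => qE; exists q; split=> // j.
rewrite /q /fval; move: (f (_ + _)) (f x) (grad f x d) critical => u v w w0.
by rewrite !mxE mulVKf ?gt_eqF // lerDl oppr_ge0 pmulr_rle0.
Qed.

Lemma asymptotic_grad_ge0 (v : 'rV[R]_m) (z : 'rV[R]_n) :
  (forall y, K (g y) -> fval f x <= fval f y) ->
  T2asym K (g x) (grad g x d) v -> polar (Ndir K (g x) (grad g x d)) (grad g x z - v) ->
  0 <= grad f x z 0 0.
Proof.
move=> x_min [t [r [ws [dt [dr [tr0 [wsv Kws]]]]]]] zv_polar.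
have [[t_gt0 _] [r_gt0 r0]] := (dt, dr).
pose s j := 2^-1 * t j * r j.
have s_gt0 j : 0 < s j by rewrite !mulr_gt0 ?invr_gt0.
have st0 : s j / t j @[j --> \oo] --> 0 by exact: half_ratio_cvg0 dt r0 _.
rewrite -[grad g x z]addr0 in zv_polar.
have [zs zsz Kzs] := feasible_arc g_C2 Kcl Kgx foscms zv_polar dt s_gt0 st0 wsv Kws
  (asymptotic_quotient_cvg0 x d g_C2 dt dr tr0).
have [q [qL fq]] := fval_arc dt s_gt0 (cvg0_of_ratio dt st0) zsz
  (asymptotic_quotient_cvg0 x d f_C2 dt dr tr0).
rewrite mxE addr0 in qL; apply: (cvgr_to_ge qL); apply: nearW => j.
by rewrite -(pmulr_rge0 _ (s_gt0 j)); apply: le_trans (fq j); rewrite subr_ge0 x_min.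
Qed.

Lemma second_order_growth_le (S : set 'rV[R]_n) (kappa rho : R) (w : 'rV[R]_m)
    (z : 'rV[R]_n) :
  S x -> 0 < kappa -> 0 < rho ->
  (forall y, K (g y) -> eunorm (y - x) < rho ->
     fval f x + kappa * setdist y S ^+ 2 <= fval f y) ->
  T2set K (g x) (grad g x d) w ->
  polar (Ndir K (g x) (grad g x d)) (grad g x z + hess2 g x d - w) ->
  2 * kappa * setdist d (Tcone S x) ^+ 2 <= grad f x z 0 0 + hess2 f x d 0 0.
Proof.
move=> Sx k0 rho0 growth [t [ws [dt [wsw Kws]]]] zw_polar; have [t_gt0 t0] := dt.
pose s j := 2^-1 * t j ^+ 2.
have s_gt0 j : 0 < s j by rewrite mulr_gt0 ?invr_gt0 ?exprn_gt0.
have st0 : s j / t j @[j --> \oo] --> 0.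
  by apply: half_ratio_cvg0 dt t0 _ => j; rewrite -mulrA.
have [zs zsz Kzs] := feasible_arc g_C2 Kcl Kgx foscms zw_polar dt s_gt0 st0 wsw Kws
  (second_order_quotient_seq g_C2 dt).
have [q [qL fq]] := fval_arc dt s_gt0 (cvg0_of_ratio dt st0) zsz
  (second_order_quotient_seq f_C2 dt).
pose v j := d + (s j / t j) *: zs j.
have vd : v @ \oo --> d by exact: (cvg_ratioD (u := d) st0 zsz).
have vE j : x + t j *: v j = x + t j *: d + s j *: zs j.
  by rewrite scaler_ratioD ?addrA // gt_eqF.
have xs_near : \forall j \near \oo, eunorm (t j *: v j) < rho.
  apply: (cvgr_lt 0) rho0; rewrite -(eunorm0 R n) -(scale0r d).
  by apply: cvg_eunorm; exact: cvgZ.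
have dist_le : \forall j \near \oo,
    setdist (x + t j *: v j) S ^+ 2 <= t j ^+ 2 * (q j / (2 * kappa)).
  apply: filterS xs_near => j xj; rewrite -(ler_pM2l k0).
  have := growth _ (Kzs j); rewrite -vE addrAC subrr add0r => /(_ xj).
  have -> : kappa * (t j ^+ 2 * (q j / (2 * kappa))) = s j * q j.
    by rewrite /s; field; rewrite gt_eqF.
  by have := fq j; rewrite -vE; lra.
have : setdist d (Tcone S x) ^+ 2 <= (grad f x z 0 0 + hess2 f x d 0 0) / (2 * kappa).
  by apply: (setdist_Tcone_sqr_le Sx dt vd _ dist_le); exact: cvgMr_tmp.
by rewrite ler_pdivlMr ?mulr_gt0 // mulrC.
Qed.

End Conditions.

Section Multipliers.
Variables (R : realType) (n m : nat).
Variables (f : 'rV[R]_n -> 'rV[R]_1) (g : 'rV[R]_n -> 'rV[R]_m) (K : set 'rV[R]_m).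
Variables (x d : 'rV[R]_n).
Hypotheses (f_C2 : C2 f) (g_C2 : C2 g) (Kcl : closed K).
Hypotheses (xS : Sol f g K x) (dC : Ccone f g K x d) (rcq : DirRCQ g K x d).

Lemma DirRCQ_FOSCMS : FOSCMS g K x d.
Proof. by move=> l Nl; apply: rcq; exact: Ndir_sub_NCdir. Qed.

Lemma Lambdac_duality (b : 'rV[R]_m) (gam : R) :
  (exists2 l, Lambdac f g K x d l & gam <= dotv l b) \/
  (exists2 z, polar (Ndir K (g x) (grad g x d)) (grad g x z + b) & grad f x z 0 0 < gam).
Proof.
pose J := jacobian g x; pose c : 'rV[R]_n := (jacobian f x)^T.
have grad_f h : grad f x h 0 0 = dotv c h.
  rewrite gradE /c; move: (jacobian f x) => A.
  by rewrite mxE; apply: eq_bigr => i _; rewrite mxE mulrC.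
have [|||[l [Nl lJ bl]]|[z Nz zc]] :=
    @cone_duality _ _ _ J (NCdir K (g x) (grad g x d)) _ _ _ c b gam.
- exact: closed_closure.
- by apply: NCdir_convex_cone; case: dC.
- by move=> l Nl lJ; apply: rcq => // h; rewrite gradE dotv_mulmx lJ dotv0l.
- left; exists l => //; split=> // h.
  by rewrite grad_f gradE dotv_mulmx lJ dotvNl subrr.
- right; exists z; last by rewrite grad_f.
  by move=> l Nl; rewrite gradE; apply: Nz; exact: Ndir_sub_NCdir.
Qed.

Lemma Sol_prop_i : prop_i f g K x d.
Proof.
move=> v Tv; have [[l Ll vl]|[z Nz z_lt0]] := Lambdac_duality (- v) 0.
  by exists l; split=> //; move: vl; rewrite dotvNr oppr_ge0.
have := asymptotic_grad_ge0 f_C2 g_C2 Kcl xS.1 DirRCQ_FOSCMS dC.2 xS.2 Tv Nz.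
by rewrite leNgt z_lt0.
Qed.

Lemma growth_prop_ii (kappa rho : R) : 0 < kappa -> 0 < rho ->
  (forall y, K (g y) -> eunorm (y - x) < rho ->
     fval f x + kappa * setdist y (Sol f g K) ^+ 2 <= fval f y) ->
  prop_ii f g K x d (2 * kappa * setdist d (Tcone (Sol f g K) x) ^+ 2).
Proof.
move=> k0 rho0 growth w Tw; set rhs := 2 * kappa * _.
have [[l Ll wl]|[z Nz z_lt]] :=
    Lambdac_duality (hess2 g x d - w) (rhs - hess2 f x d 0 0).
  by exists l; split=> //; move: wl; rewrite dotvDr dotvNr /hessL; lra.
rewrite addrA in Nz.
have := second_order_growth_le f_C2 g_C2 Kcl xS.1 DirRCQ_FOSCMS dC.2 xS k0 rho0
  growth Tw Nz.
by rewrite -lerBlDr leNgt z_lt.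
Qed.

End Multipliers.

Lemma local_sowsm_growth (R : realType) (n m : nat) (f : 'rV[R]_n -> 'rV[R]_1)
    (g : 'rV[R]_n -> 'rV[R]_m) (K : set 'rV[R]_m) (xbar x : 'rV[R]_n) (kappa delta : R) :
  local_sowsm f g K xbar kappa delta -> Sol f g K x -> eball xbar delta x ->
  exists2 rho : R, 0 < rho & forall y, K (g y) -> eunorm (y - x) < rho ->
    fval f x + kappa * setdist y (Sol f g K) ^+ 2 <= fval f y.
Proof.
move=> [Pxbar growth] [_ xmin] xb; exists (delta - eunorm (x - xbar)).
  by rewrite subr_gt0.
move=> y Ky yx; apply: le_trans (growth y Ky _); first by rewrite lerD2r xmin.
by apply: le_lt_trans (eunorm_distD x _ _) _; rewrite -ltrBrDr.
Qed.

Lemma NPeps_setdist_Tcone (R : realType) (n : nat) (S : set 'rV[R]_n)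
    (x d : 'rV[R]_n) (eps : R) : S x -> NPeps S x eps d ->
  (1 - 2 * eps) * eunorm d <= setdist d (Tcone S x).
Proof.
move=> Sx d_eps; apply: setdist_ge => [|v Tv]; first by exists 0; exact: Tcone0.
suff : (1 - 2 * eps) * eunorm d - eunorm (d - v) <= 0 by lra.
apply/ler_addgt0Pr => e e0; rewrite add0r.
have NP0 : NPcone S x !=set0.
  exists 0; split=> //; exists 1; split=> // a _.
  by rewrite scaler0 addr0 subrr eunorm0.
have [|p Np dp] := @setdist_lt _ _ d _ (eps * eunorm d + e / 2) NP0.
  by apply: le_lt_trans d_eps _; rewrite ltrDl divr_gt0.
have pp : eunorm p <= eunorm (p - v).
  rewrite -ler_sqr ?nnegrE // !sqr_eunorm !dotvE (dotvC p).
  by have := NPcone_polar_Tcone Np Tv; have := dotvv_ge0 v; lra.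
have := eunorm_distD d p v; rewrite (eunorm_distC p d).
have := eunorm_distD p d 0; rewrite !subr0; lra.
Qed.

Theorem theorem3p9 (R : realType) (n m : nat)
  (f : 'rV[R]_n -> 'rV[R]_1) (g : 'rV[R]_n -> 'rV[R]_m) (K : set 'rV[R]_m)
  (xbar : 'rV[R]_n) (kappa delta : R) :
  C2 f -> C2 g -> closed K -> Sol f g K !=set0 ->
  0 < kappa -> 0 < delta ->
  local_sowsm f g K xbar kappa delta ->
  (forall x, Phi g K x -> eball xbar delta x ->
     forall d, Ccone f g K x d -> DirRCQ g K x d) ->
  (forall (eps : R) (x d : 'rV[R]_n),
     0 <= eps -> eps < 2^-1 ->
     Sol f g K x -> eball xbar delta x ->
     Ccone f g K x d -> NPeps (Sol f g K) x eps d ->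
     prop_i f g K x d /\
     prop_ii f g K x d (2 * kappa * (1 - 2 * eps) ^+ 2 * eunorm d ^+ 2)) /\
  (forall x d : 'rV[R]_n,
     Sol f g K x -> eball xbar delta x -> Ccone f g K x d ->
     prop_i f g K x d /\
     prop_ii f g K x d (2 * kappa * setdist d (Tcone (Sol f g K) x) ^+ 2)).
Proof.
move=> f_C2 g_C2 Kcl _ k0 _ weak_sharp rcq.
have tangent_bound (x d : 'rV[R]_n) :
    Sol f g K x -> eball xbar delta x -> Ccone f g K x d ->
    prop_i f g K x d /\
    prop_ii f g K x d (2 * kappa * setdist d (Tcone (Sol f g K) x) ^+ 2).
  move=> xS xb dC; have rcq_d := rcq x xS.1 xb d dC.
  have [rho rho0 growth] := local_sowsm_growth weak_sharp xS xb.
  by split; [exact: Sol_prop_i|exact: growth_prop_ii growth].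
split=> // eps x d eps0 eps1 xS xb dC d_eps.
have [holds_i holds_ii] := tangent_bound x d xS xb dC.
split=> // w /holds_ii[l [Ll bound]]; exists l; split=> //; apply: le_trans bound.
rewrite -mulrA -exprMn ler_pM2l ?mulr_gt0 //.
have proximal_bound := NPeps_setdist_Tcone xS d_eps.
have eps_ge0 : 0 <= (1 - 2 * eps) * eunorm d by rewrite mulr_ge0 //; lra.
by rewrite ler_sqr ?nnegrE // (le_trans eps_ge0).
Qed.
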